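(* Let $k$ be a field, $n\ge 2$, $R=k[X_1,\dots,X_n]$ with the standard grading, $\mathfrak m=(X_1,\dots,X_n)$, and let $I=(f_0,\dots,f_n)\subset R$ be generated by $k$-linearly independent forms $f_0,\dots,f_n$ of the same degree $d\ge 1$. Assume that $I$ is $\mathfrak m$-primary. Then for every integer $p\ge2$ and every integer $\mu\ge\mu_0(I)$ the downgrading map $\lambda_p^\mu$ (defined in the context) is an isomorphism.
   Context: $H_i$ denotes the $i$-th homology module of the graded Koszul complex $K_\bullet(f_0,\dots,f_n;R)$ (with degree-preserving differentials, so $K_i\simeq R(-id)^{\binom{n+1}{i}}$). For a graded module $M$, $\mathrm{indeg}(M)=\inf\{\mu : M_\mu\ne 0\}$, with $\mathrm{indeg}(0)=+\infty$. The threshold degree is $$\mu_0(I)=(n-1)(d-1)-\min\{\mathrm{indeg}(H_1),\ \mathrm{indeg}(H^0_{\mathfrak m}(H_1))-d\}.$$ Let $R'=k[T_0,\dots,T_n]$, $S=R\otimes_kR'=R[T_0,\dots,T_n]$, $\mathcal S_I^*=\mathrm{Sym}_R(I)/H^0_{\mathfrak m}(\mathrm{Sym}_R(I))$, $J$ the kernel of the $R$-algebra map $S\to\mathcal S_I^*$ sending $T_i$ to the class of $f_i$ in symmetric degree one, and $J\langle\ell\rangle\subset J$ the ideal generated by the elements of $J$ of degree at most $\ell$ in the $T_i$'s. Let $\mathfrak{KS}\subset J\langle1\rangle$ be the $S$-ideal generated by the elements $f_iT_j-f_jT_i$, $0\le i,j\le n$. For a bigraded $S$-module $M$, $M_\mu$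 denotes its part of $X$-degree $\mu$ ($\deg X_i=1$, $\deg T_i=0$), a graded $R'$-module; $\{\cdot\}$ and $[\cdot]$ denote shifts in $T$-degree and $X$-degree respectively. Define $\delta:S/\mathfrak{KS}\to(S/\mathfrak{KS})[d]\{-1\}$ on the part of $T$-degree $p\geq 1$ by $$\sum_{0\le i_1,\dots,i_p\le n}c_{i_1,\dots,i_p}T_{i_1}\cdots T_{i_p}\mapsto\sum_{0\le i_1,\dots,i_p\le n}c_{i_1,\dots,i_p}f_{i_1}T_{i_2}\cdots T_{i_p}$$ (this is well defined). For $\mu\ge0$ it induces well-defined homogeneous maps of graded $R'$-modules $$\lambda_2^\mu:(J\langle2\rangle/J\langle1\rangle)_\mu\to(J\langle1\rangle/\mathfrak{KS})\{-1\}_{\mu+d},$$ $$\lambda_p^\mu:(J\langle p\rangle/J\langle p-1\rangle)_\mu\to(J\langle p-1\rangle/J\langle p-2\rangle)\{-1\}_{\mu+d}\quad(p\ge3).$$ Standing assumption in the paper: $\dim k[f_0,\dots,f_n]=\dim R$. *)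

(* Defs.v *)
From HB Require Import structures.
From mathcomp Require Import all_boot all_order all_algebra.
(* [mpoly] must be imported before [classical_sets]: in the other order their
   notations clash. *)
From mathcomp Require Import mpoly.
From mathcomp Require Import boolp classical_sets constructive_ereal.

Set Implicit Arguments.
Unset Strict Implicit.
Unset Printing Implicit Defensive.

Import Order.TTheory GRing.Theory.
Local Open Scope classical_set_scope.
Local Open Scope quotient_scope.
Local Open Scope ring_scope.

Section Submodule.
Context {R : nzRingType} {V : lmodType R}.

Record submodule :=
  Submodule { submod_pred :> {pred V}; submodP : submod_closed submod_pred }.

HB.instance Definition _ (A : submodule) :=
  GRing.isSubmodClosed.Build R V (submod_pred A) (submodP A).

End Submodule.
Arguments submodule {R} V.

Section SubmoduleType.
Context {R : nzRingType} {V : lmodType R} (A : submodule V).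

Record submod_of := SubmodOf { submod_val : V; submod_valP : submod_val \in A }.

HB.instance Definition _ := [isSub for submod_val].
HB.instance Definition _ := [Choice of submod_of by <:].
HB.instance Definition _ := [SubChoice_isSubLmodule of submod_of by <:].

End SubmoduleType.

Section QuotientModule.
Context {R : nzRingType} {V : lmodType R} (B : submodule V).

Definition quotmod := Quotient.quot B.

HB.instance Definition _ := EqQuotient.on quotmod.
HB.instance Definition _ := GRing.Zmodule.on quotmod.

Lemma quotmod_eqP (x y : V) : reflect (\pi_quotmod x = \pi_quotmod y) (x - y \in B).
Proof. by rewrite Quotient.idealrBE; apply: eqP. Qed.

Lemma pi_quotmodD : {morph \pi_quotmod : x y / x + y}.
Proof. exact: Quotient.pi_add. Qed.

Lemma quotmodP (x : quotmod) : exists y, x = \pi_quotmod y.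
Proof. by exists (repr x); rewrite reprK. Qed.

Definition quotmod_scale (a : R) (x : quotmod) : quotmod := \pi_quotmod (a *: repr x).

Lemma pi_quotmodZ a x : \pi_quotmod (a *: x) = quotmod_scale a (\pi x).
Proof.
apply/quotmod_eqP; rewrite -scalerBr; apply: rpredZ.
by apply/quotmod_eqP; rewrite reprK.
Qed.

Fact quotmod_scaleA a b x :
  quotmod_scale a (quotmod_scale b x) = quotmod_scale (a * b) x.
Proof.
have [y ->] := quotmodP x.
by rewrite -(pi_quotmodZ b) -(pi_quotmodZ a) -(pi_quotmodZ (a * b)) scalerA.
Qed.

Fact quotmod_scale1 : left_id 1 quotmod_scale.
Proof. by move=> x; have [y ->] := quotmodP x; rewrite -pi_quotmodZ scale1r. Qed.

Fact quotmod_scaleDr : right_distributive quotmod_scale +%R.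
Proof.
move=> a x y; have [u ->] := quotmodP x; have [v ->] := quotmodP y.
by rewrite -pi_quotmodD -(pi_quotmodZ a (u + v)) -(pi_quotmodZ a u)
  -(pi_quotmodZ a v) scalerDr pi_quotmodD.
Qed.

Fact quotmod_scaleDl x : {morph quotmod_scale^~ x : a b / a + b}.
Proof.
move=> a b; have [y ->] := quotmodP x.
by rewrite -(pi_quotmodZ (a + b)) -(pi_quotmodZ a) -(pi_quotmodZ b)
  scalerDl pi_quotmodD.
Qed.

HB.instance Definition _ := GRing.Zmodule_isLmodule.Build R quotmod
  quotmod_scaleA quotmod_scale1 quotmod_scaleDr quotmod_scaleDl.

End QuotientModule.

(* The quotient A / (A :&: B), that is A / B when B is contained in A. *)
Section Subquotient.
Context {R : nzRingType} {V : lmodType R} (A B : submodule V).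

Definition submod_trace : {pred submod_of A} := fun x => submod_val x \in B.

Fact submod_trace_closed : submod_closed submod_trace.
Proof.
split=> [|a x y xB yB]; rewrite unfold_in /submod_trace.
  exact: (rpred0 B).
by rewrite -[submod_val _]/(\val _) linearP rpredD ?rpredZ.
Qed.

Definition subquot := quotmod (Submodule submod_trace_closed).

HB.instance Definition _ := GRing.Lmodule.on subquot.

Definition subquot_class (x : submod_of A) : subquot := \pi_subquot x.

End Subquotient.

Section Ideals.
Context {A : comNzRingType}.
Implicit Types (G : set A) (I P B : set A).

Definition ideal_gen G : {pred A} := fun x =>
  `[< exists (m : nat) (a g : 'I_m -> A),
        (forall i, G (g i)) /\ x = \sum_i a i * g i >].

Lemma ideal_gen_sub G x : G x -> x \in ideal_gen G.
Proof.
move=> Gx; apply/asboolP; exists 1%N, (fun=> 1), (fun=> x); split=> //.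
by rewrite big_ord1 mul1r.
Qed.

Fact ideal_gen_submod_closed G :
  submod_closed (ideal_gen G : {pred A^o}).
Proof.
split=> [|c x y].
  apply/asboolP; exists 0%N, (fun=> 0), (fun=> 0); split=> [[]//|].
  by rewrite big_ord0.
move=> /asboolP[p [a [g [Gg ->]]]] /asboolP[q [b [h [Gh ->]]]].
apply/asboolP; exists (p + q)%N.
exists (fun i => match split i with inl j => c * a j | inr j => b j end).
exists (fun i => match split i with inl j => g j | inr j => h j end).
split=> [i|]; first by case: (split i).
rewrite big_split_ord /=; congr (_ + _).
  rewrite scaler_sumr; apply: eq_bigr => i _.
  by rewrite -[lshift q i]/(unsplit (inl i)) unsplitK; apply: mulrA.
by apply: eq_bigr => i _; rewrite -[rshift p i]/(unsplit (inr i)) unsplitK.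
Qed.

Definition ideal_mod G : submodule A^o := Submodule (ideal_gen_submod_closed G).

Definition ideal_pow I (N : nat) : {pred A} :=
  ideal_gen [set x | exists g : 'I_N -> A,
                       (forall i, I (g i)) /\ x = \prod_i g i].

Definition primary_ideal I :=
  ~ I 1 /\ forall a b, I (a * b) -> I a \/ exists N, I (b ^+ N).

Definition radical I : set A := [set x | exists N, I (x ^+ N)].

(* [P] is a prime ideal of the subring [B] of [A]. *)
Definition prime_ideal_of B P :=
  [/\ forall x, P x -> B x,
      P 0 /\ forall x y, P x -> P y -> P (x + y),
      forall b x, B b -> P x -> P (b * x),
      ~ P 1 &
      forall a b, B a -> B b -> P (a * b) -> P a \/ P b].

Definition prime_chain B (m : nat) := exists P : nat -> set A,
  (forall i, (i <= m)%N -> prime_ideal_of B (P i)) /\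
  (forall i, (i < m)%N -> P i `<=` P i.+1 /\ ~ (P i.+1 `<=` P i)).

(* Krull dimension of the subring [B], in [\bar int]. *)
Definition krull_dim B : \bar int :=
  supremum -oo%E [set (m%:Z)%:E | m in [set m : nat | prime_chain B m]].

End Ideals.

Definition is_symmetric_algebra (R : comNzRingType) (M : lmodType R)
    (Sym : comAlgType R) (iota : {linear M -> Sym}) :=
  forall (A : comAlgType R) (g : {linear M -> A}),
  exists h : {lrmorphism Sym -> A},
    (forall x, h (iota x) = g x) /\
    (forall h' : {lrmorphism Sym -> A}, (forall x, h' (iota x) = g x) -> h' =1 h).

(* Initial degree of a graded module, given as the family [part] of its
   homogeneous components; it is [+oo] for the zero module. *)
Definition indeg (M : zmodType) (part : int -> set M) : \bar int :=
  infimum +oo%E [set mu%:E | mu in [set mu : int | exists2 x, part mu x & x <> 0]].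

Section PolynomialRing.
Context {k : fieldType} {n : nat}.
Local Notation R := {mpoly k[n]}.

(* The forms of degree [e]; only [0] when [e] is negative. *)
Definition is_form (e : int) (r : R) : bool :=
  if e is Posz d then r \is d.-homog else r == 0.

Definition maxideal : {pred R} := ideal_gen [set r | exists i, r = 'X_i].

(* H^0_m(M) *)
Definition torsion (M : lmodType R) : set M :=
  [set x | exists N, forall r, r \in ideal_pow [set` maxideal] N -> r *: x = 0].

Definition is_m_primary (I : {pred R}) :=
  primary_ideal [set` I] /\ radical [set` I] = [set` maxideal].

End PolynomialRing.
Arguments torsion {k n} M _.

Section Koszul.
Context {k : fieldType} {n m : nat} (d : nat) (f : 'I_m -> {mpoly k[n]}).
Local Notation R := {mpoly k[n]}.

(* The exterior algebra of R^m: [x s] is the coefficient of the basis element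
   e_{i_1} /\ ... /\ e_{i_p}, where s = {i_1 < ... < i_p}.  The regular module
   R^o makes it an R-module; with R instead it would be a k-module. *)
Definition koszul := {ffun {set 'I_m} -> R^o}.

HB.instance Definition _ := GRing.Lmodule.on koszul.

Definition koszul_diff (x : koszul) : koszul :=
  [ffun s : {set 'I_m} => \sum_(j : 'I_m | j \notin s)
     (-1) ^+ #|[set i in s | (i < j)%N]| * f j * x (j |: s)].

Definition koszul_chain (i : nat) (x : koszul) : bool :=
  [forall s : {set 'I_m}, (x s != 0) ==> (#|s| == i)].

Definition koszul_cycle (i : nat) : {pred koszul} :=
  fun x => koszul_chain i x && (koszul_diff x == 0).

Definition koszul_boundary (i : nat) : {pred koszul} :=
  fun x => `[< exists2 y, koszul_chain i.+1 y & x = koszul_diff y >].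

Lemma koszul_diffP (a : R) x y :
  koszul_diff (a *: x + y) = a *: koszul_diff x + koszul_diff y.
Proof.
apply/ffunP => s; rewrite !ffunE scaler_sumr -big_split /=.
apply: eq_bigr => j _; rewrite !ffunE mulrDr; congr (_ + _).
exact: mulrCA.
Qed.

Lemma koszul_chainP i (x : koszul) :
  reflect (forall s : {set 'I_m}, #|s| != i -> x s = 0) (koszul_chain i x).
Proof.
apply: (iffP forallP) => [h s si|h s].
  by apply/eqP; apply: contraNT si; apply/implyP.
by apply/implyP; apply: contraR => /h ->.
Qed.

Fact koszul_chain_closed i : submod_closed (koszul_chain i : {pred koszul}).
Proof.
split=> [|a x y /koszul_chainP xi /koszul_chainP yi]; apply/koszul_chainP => s si.
  by rewrite ffunE.
by rewrite !ffunE xi ?yi // scaler0 addr0.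
Qed.

Fact koszul_cycle_closed i : submod_closed (koszul_cycle i).
Proof.
have [c0 cD] := koszul_chain_closed i.
have d0 : koszul_diff 0 = 0.
  by have := koszul_diffP (-1) 0 0; rewrite scaleN1r addr0 oppr0 scaleN1r addNr.
split=> [|a x y]; first by apply/andP; split; [exact: c0 | rewrite d0].
move=> /andP[xi /eqP dx] /andP[yi /eqP dy]; apply/andP; split; first exact: cD.
by rewrite koszul_diffP dx dy scaler0 addr0.
Qed.

Fact koszul_boundary_closed i : submod_closed (koszul_boundary i).
Proof.
have [c0 cD] := koszul_chain_closed i.+1.
split=> [|a x y].
  apply/asboolP; exists 0; first exact: c0.
  by have := koszul_diffP (-1) 0 0; rewrite scaleN1r addr0 oppr0 scaleN1r addNr => ->.
move=> /asboolP[u uc ->] /asboolP[v vc ->]; apply/asboolP.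
by exists (a *: u + v); [exact: cD | rewrite koszul_diffP].
Qed.

Definition koszul_homology (i : nat) := subquot
  (Submodule (koszul_cycle_closed i)) (Submodule (koszul_boundary_closed i)).

HB.instance Definition _ i := GRing.Lmodule.on (koszul_homology i).

(* The component of degree [mu]: as K_i is a sum of copies of R(-id), the
   coefficients of a homogeneous chain of degree [mu] have degree mu - id. *)
Definition koszul_homology_part (i : nat) (mu : int) : set (koszul_homology i) :=
  [set x | exists2 z : submod_of (Submodule (koszul_cycle_closed i)),
             forall s, is_form (mu - (i * d)%N%:Z) (submod_val z s) &
             x = subquot_class _ z].

Definition koszul_torsion_part (i : nat) (mu : int) : set (koszul_homology i) :=
  koszul_homology_part mu `&` torsion (koszul_homology i).

End Koszul.
Arguments koszul_homology_part {k n m} d f i mu _.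
Arguments koszul_torsion_part {k n m} d f i mu _.

Definition threshold (k : fieldType) (n d : nat)
    (f : 'I_n.+1 -> {mpoly k[n]}) : \bar int :=
  (((n%:Z - 1) * (d%:Z - 1))%:E
   - mine (indeg (koszul_homology_part d f 1))
          (indeg (koszul_torsion_part d f 1) - d%:Z%:E))%E.

Section Downgrading.
Context {k : fieldType} {n : nat} (d : nat) (f : 'I_n.+1 -> {mpoly k[n]}).
Local Notation R := {mpoly k[n]}.
Local Notation S := {mpoly R[n.+1]}.
Local Notation R' := {mpoly k[n.+1]}.

Definition ideal_of : submodule R^o := ideal_mod (range f).

Fact gen_in_ideal i : f i \in ideal_of.
Proof. by apply: ideal_gen_sub; exists i. Qed.

Definition ideal_gen_elt i : submod_of ideal_of := SubmodOf (gen_in_ideal i).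

(* S seen as an R'-module: the scalars k[T_0, ..., T_n] act through the
   coefficientwise inclusion of k in R. *)
Definition bipoly := S.

HB.instance Definition _ := GRing.Zmodule.on bipoly.

Definition coef_incl (a : R') : S := map_mpoly (@mpolyC n k) a.

Definition bipoly_scale (a : R') (s : bipoly) : bipoly := coef_incl a * s.

Fact bipoly_scaleA a b s : bipoly_scale a (bipoly_scale b s) = bipoly_scale (a * b) s.
Proof. by rewrite /bipoly_scale /coef_incl rmorphM mulrA. Qed.

Fact bipoly_scale1 : left_id 1 bipoly_scale.
Proof. by move=> s; rewrite /bipoly_scale /coef_incl rmorph1 mul1r. Qed.

Fact bipoly_scaleDr : right_distributive bipoly_scale +%R.
Proof. by move=> a s t; apply: mulrDr. Qed.

Fact bipoly_scaleDl s : {morph bipoly_scale^~ s : a b / a + b}.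
Proof. by move=> a b; rewrite /bipoly_scale /coef_incl rmorphD; apply: mulrDl. Qed.

HB.instance Definition _ := GRing.Zmodule_isLmodule.Build R' bipoly
  bipoly_scaleA bipoly_scale1 bipoly_scaleDr bipoly_scaleDl.

Definition is_Xform (mu : int) (s : S) : bool :=
  all (fun m => is_form mu s@_m) (msupp s).

Lemma is_XformP mu s : reflect (forall m, is_form mu s@_m) (is_Xform mu s).
Proof.
apply: (iffP allP) => [h m|h m _]; last exact: h.
case: (boolP (m \in msupp s)) => [/h //|/memN_msupp_eq0 ->].
by case: mu {h} => [e|e] /=; rewrite ?dhomog0.
Qed.

Lemma is_form_closed mu : submod_closed (is_form mu : {pred R}).
Proof.
case: mu => [e|e]; first exact: dhomog_submod_closed.
split=> [|a x y]; rewrite !unfold_in //= => /eqP -> /eqP ->.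
by rewrite scaler0 addr0.
Qed.

Lemma is_Xform_closed mu : submod_closed (is_Xform mu : {pred bipoly}).
Proof.
have [f0 fD] := @is_form_closed mu.
have form_sum I (r : seq I) (P : pred I) (F : I -> R) :
    (forall i, is_form mu (F i)) -> is_form mu (\sum_(i <- r | P i) F i).
  move=> FP; elim/big_ind: _ => // x y xf yf.
  by rewrite -[x]scale1r; apply: fD.
split=> [|a x y /is_XformP xP /is_XformP yP]; apply/is_XformP => m.
  by rewrite mcoeff0.
rewrite mcoeffD -[X in is_form _ (X + _)]scale1r; apply: (fD); last exact: yP.
rewrite unfold_in mcoeffM; apply: form_sum => -[u v] /=.
rewrite /coef_incl mcoeff_map_mpoly mul_mpolyC -[X in is_form _ X]addr0.
by apply: fD => //; exact: xP.
Qed.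

Definition KS : submodule S^o :=
  ideal_mod [set s | exists i j : 'I_n.+1, s = f i *: 'X_j - f j *: 'X_i].

Section SymmetricAlgebra.
Context (Sym : comAlgType R) (iota : {linear submod_of ideal_of -> Sym}).

(* The R-algebra map from S to Sym_R(I) with T_i |-> f_i. *)
Definition to_sym (s : S) : Sym :=
  mmap (in_alg Sym) (fun i => iota (ideal_gen_elt i)) s.

(* The kernel of the composite S -> Sym_R(I) -> Sym_R(I) / H^0_m(Sym_R(I)). *)
Definition J : set S := [set s | torsion Sym (to_sym s)].

Definition Jle (l : nat) : submodule S^o :=
  ideal_mod [set s | J s /\ (msize s <= l.+1)%N].

(* [Jpred l] is the submodule by which J<l> is divided: J<l-1>, but KS if l = 1. *)
Definition Jpred (l : nat) : submodule S^o := if l == 1 then KS else Jle l.-1.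

Fact Xpart_closed (I : submodule S^o) mu :
  submod_closed ([pred s | (s \in I) && is_Xform mu s] : {pred bipoly}).
Proof.
have [x0 xD] := @is_Xform_closed mu.
split=> [|a x y /andP[xI xX] /andP[yI yX]]; apply/andP; split.
- exact: (rpred0 I).
- exact: x0.
- by have [_ ID] := submodP I; apply: (ID (coef_incl a : S) x y xI yI).
- exact: xD.
Qed.

Definition Xpart (I : submodule S^o) (mu : int) : submodule bipoly :=
  Submodule (Xpart_closed I mu).

(* (J<l>/J<l-1>)_mu for l >= 2, and (J<1>/KS)_mu for l = 1. *)
Definition Jgraded (l : nat) (mu : int) : lmodType R' :=
  subquot (Xpart (Jle l) mu) (Xpart (Jpred l) mu).

(* An element of T-degree p is given by a family of coefficients, which need
   not be symmetric and is therefore not unique; accordingly [delta_Tpoly c] is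
   determined by [Tpoly c] only modulo KS. *)
Definition Tpoly (p : nat) (c : p.-tuple 'I_n.+1 -> R) : S :=
  \sum_(i : p.-tuple 'I_n.+1) c i *: \prod_(j <- i) 'X_j.

Definition delta_Tpoly (p : nat) (c : p.+1.-tuple 'I_n.+1 -> R) : S :=
  \sum_(i : p.+1.-tuple 'I_n.+1)
     (c i * f (thead i)) *: \prod_(j <- behead i) 'X_j.

(* [phi] is the map lambda_p^mu induced by delta.  Both s and delta(s) are given
   by families of coefficients modulo KS (these coefficients need not be forms,
   so that [delta_Tpoly c] may fail to be homogeneous in X).  As J<p> is homogeneous for the
   T-grading and J has no nonzero element of T-degree 0, the condition
   determines an additive [phi]; it also shows that [phi] lowers T-degrees
   by 1. *)
Definition is_downgrading (p : nat) (mu : int)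
    (phi : Jgraded p mu -> Jgraded p.-1 (mu + d%:Z)) :=
  forall (q : nat) (c : q.+1.-tuple 'I_n.+1 -> R)
         (s : submod_of (Xpart (Jle p) mu)),
    submod_val s - Tpoly c \in KS ->
    exists2 t : submod_of (Xpart (Jle p.-1) (mu + d%:Z)),
      submod_val t - delta_Tpoly c \in KS &
      phi (subquot_class _ s) = subquot_class _ t.

End SymmetricAlgebra.
End Downgrading.

(* Main.v *)
From HB Require Import structures.
Require Import Defs.
From mathcomp Require Import all_boot all_order all_algebra.
From mathcomp Require Import ssrcomplements mpoly.
From mathcomp Require Import boolp classical_sets constructive_ereal.
From mathcomp Require Import zify ring.

(* Write X for the variables of R and T for those of S.  Since I is m-primary,
   J is the kernel of S -> R[t], T_i |-> f_i t.  Two facts about delta, taken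
   modulo KS, suffice.
   - Its kernel on J lies in J<1>: if s = sum T_i q_i and sum f_i q_i is in KS,
     the q_i can be corrected, without changing s, so that sum f_i q_i = 0.
   - If every form of degree mu + d lies in I, an element of J of X-degree
     mu + d has coefficients sum b_i f_i and is the image of the element of J
     obtained by replacing each f_i by T_i.
   So it remains to see that R_e = I_e for e >= mu + d, i.e. that the lowest
   degree of H_1 controls the top degree of R/I.  Let I contain all y_i = X_i^(N+1).
   As y_1, ..., y_n is a regular sequence in I, division by y_(r+1) of the
   differential embeds the homology H_(r+2) of K(f; R/(y_1, ..., y_(r+1))) into
   H_(r+1) of K(f; R/(y_1, ..., y_r)), hence (y : I)/(y) into H_1, lowering
   degrees by n(N+1-d) - d.  Finally (y : I)/(y) in degree nN - e is dual to (R/I)_e,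
   by the pairing R/(y) x R/(y) -> k that reads off the coefficient of
   (X_1 ... X_n)^N. *)

Set Implicit Arguments.
Unset Strict Implicit.
Unset Printing Implicit Defensive.

Import Order.TTheory GRing.Theory.
Local Open Scope classical_set_scope.
Local Open Scope ring_scope.

(** * Subquotients and ideals *)

Section Subquotient.
Context {R : nzRingType} {V : lmodType R} (A B : submodule V).
Implicit Types x y : submod_of A.

Lemma subquot_eqP x y : reflect (subquot_class B x = subquot_class B y)
  (submod_val x - submod_val y \in B).
Proof. exact: (@quotmod_eqP _ _ (Submodule (@submod_trace_closed _ _ A B)) x y). Qed.

Lemma subquotP (c : subquot A B) : exists x, c = subquot_class B x.
Proof. exact: (@quotmodP _ _ (Submodule (@submod_trace_closed _ _ A B))). Qed.

Fact subquot_class_is_linear : linear (subquot_class B : submod_of A -> subquot A B).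
Proof.
move=> a x y.
rewrite /subquot_class [LHS](@pi_quotmodD _ _ (Submodule (@submod_trace_closed _ _ A B))).
by rewrite [X in X + _](@pi_quotmodZ _ _ (Submodule (@submod_trace_closed _ _ A B))).
Qed.

HB.instance Definition _ := GRing.isLinear.Build R (submod_of A) (subquot A B) _
  (subquot_class B) subquot_class_is_linear.

Lemma subquot_class_eq0 x : subquot_class B x = 0 <-> submod_val x \in B.
Proof.
rewrite -[0](linear0 (subquot_class B : {linear _ -> _})).
by split=> [/subquot_eqP|xB]; [|apply/subquot_eqP]; rewrite subr0.
Qed.

End Subquotient.

Section InducedMap.
Context {R : nzRingType} {V W : lmodType R} {A B : submodule V} {A' B' : submodule W}.
Context (g : submod_of A -> submod_of A').
Local Notation cl := (subquot_class B).
Local Notation cl' := (subquot_class B').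

(** Linearity of [g] is only asked modulo [B'], because delta is linear over the polynomials in T
    only modulo KS. *)
Lemma subquot_induced :
  (forall a s t, submod_val (g (a *: s + t)) -
     (a *: submod_val (g s) + submod_val (g t)) \in B') ->
  (forall s, submod_val s \in B -> submod_val (g s) \in B') ->
  exists phi : {linear subquot A B -> subquot A' B'}, forall s, phi (cl s) = cl' (g s).
Proof.
move=> g_lin gB; have /choice[rep repE] := @subquotP _ _ A B.
pose phi c := cl' (g (rep c)).
have phiE s : phi (cl s) = cl' (g s).
  apply/subquot_eqP; set r := rep _.
  have /gB : submod_val (r - s) \in B by apply/subquot_eqP; rewrite -repE.
  (* Linearity at [a = -1] compares g(r - s) with g(r) - g(s) modulo [B']. *)
  have := g_lin (-1) s r; rewrite !scaleN1r [- s + r]addrC => h1 h2.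
  by have := rpredB h2 h1; rewrite opprB addrCA subrr addr0 addrC.
have phi_lin : linear phi.
  move=> a c c'; rewrite [c]repE [c']repE -linearP !phiE -linearP.
  by apply/subquot_eqP; apply: g_lin.
pose L := GRing.isLinear.Build _ _ _ _ phi phi_lin.
pose F : {linear subquot A B -> subquot A' B'} := HB.pack phi L.
by exists F => s; apply: phiE.
Qed.

Lemma subquot_induced_bij (phi : {linear subquot A B -> subquot A' B'}) :
  (forall s, phi (cl s) = cl' (g s)) ->
  (forall s, submod_val (g s) \in B' -> submod_val s \in B) ->
  (forall t : submod_of A', exists s, submod_val (g s) - submod_val t \in B') ->
  bijective phi.
Proof.
move=> phiE g_inj g_surj.
have phi_inj : injective phi.
  apply: raddf_inj => c; have [s ->] := subquotP c => phi0.
  have /subquot_class_eq0/g_inj : cl' (g s) = 0 by rewrite -phiE.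
  by move/subquot_class_eq0.
have /choice[psi psiE] (c : subquot A' B') : exists c', phi c' = c.
  have [t ->] := subquotP c; have [s gs] := g_surj t.
  by exists (cl s); rewrite phiE; apply/subquot_eqP.
by exists psi => // c; apply: phi_inj; rewrite psiE.
Qed.

End InducedMap.

Section IdealGen.
Context {A : comNzRingType}.

Lemma ideal_mull (B : submodule A^o) (a x : A) : x \in B -> a * x \in B.
Proof. by move=> xB; exact: (@rpredZ _ A^o B a x xB). Qed.

Lemma ideal_add (B : submodule A^o) (x y : A) : x \in B -> y \in B -> x + y \in B.
Proof. exact: (@rpredD A^o B). Qed.

Lemma ideal_sub (B : submodule A^o) (x y : A) : x \in B -> y \in B -> x - y \in B.
Proof. exact: (@rpredB A^o B). Qed.

Lemma ideal_sum (B : submodule A^o) I (r : seq I) (P : pred I) (F : I -> A) :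
  (forall i, P i -> F i \in B) -> \sum_(i <- r | P i) F i \in B.
Proof. exact: (@rpred_sum A^o B). Qed.

Lemma ideal_gen_rangeP (t : nat) (g : 'I_t -> A) x :
  x \in ideal_gen (range g) <-> exists a : 'I_t -> A, x = \sum_i a i * g i.
Proof.
split=> [/asboolP[m [a [h [hg ->]]]]|[a ->]]; last first.
  apply: (ideal_sum (B := ideal_mod (range g))) => i _; apply: ideal_mull.
  by apply: ideal_gen_sub; exists i.
elim/big_ind: _ => [|_ _ [b ->] [c ->]|i _].
- by exists (fun=> 0); rewrite big1 // => i _; rewrite mul0r.
- by exists (fun i => b i + c i); rewrite -big_split; apply: eq_bigr => i _;
    rewrite mulrDl.
have [j _ <-] := hg i; exists (fun l => if l == j then a i else 0).
rewrite (bigD1 j) //= eqxx big1 ?addr0 // => l /negPf->.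
by rewrite mul0r.
Qed.

(** Pigeonhole: expanding a product of tL + 1 elements gives multiples of products of tL + 1
    generators, in each of which one of the t generators occurs at least L times. *)
Lemma prod_ideal_gen (B : submodule A^o) (t L : nat) (g : 'I_t -> A) :
  (forall i, g i ^+ L \in B) ->
  exists M, forall x : 'I_M -> A,
    (forall j, x j \in ideal_gen (range g)) -> \prod_j x j \in B.
Proof.
move=> gB; exists (t * L).+1 => x xg.
have /choice[a xE] j : exists a : 'I_t -> A, x j = \sum_i a i * g i.
  exact/ideal_gen_rangeP.
under eq_bigr do rewrite xE; rewrite bigA_distr_bigA /=.
apply: ideal_sum => phi _; rewrite big_split /=; apply: ideal_mull.
have [i Li] : exists i, (L <= #|[pred j | phi j == i]|)%N.
  case: (boolP [exists i, (L <= #|[pred j | phi j == i]|)%N]) => [/existsP//|].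
  move=> /existsPn Lphi.
  suff: ((t * L).+1 <= t * L)%N by rewrite ltnn.
  rewrite -[X in (X <= _)%N]card_ord -sum1_card.
  rewrite (partition_big phi predT) //= -[X in (_ <= X * _)%N]card_ord -sum_nat_const.
  apply: leq_sum => i _; rewrite sum1_card; apply: ltnW.
  by rewrite ltnNge; exact: Lphi.
rewrite (bigID (fun j => phi j == i)) /= mulrC; apply: ideal_mull.
under eq_bigr => j /eqP-> do []; rewrite prodr_const -(subnK Li) exprD.
exact: ideal_mull.
Qed.

Lemma ideal_gen_pow (B : submodule A^o) (t L : nat) (g : 'I_t -> A) :
  (forall i, g i ^+ L \in B) ->
  exists M, forall x, x \in ideal_gen (range g) -> x ^+ M \in B.
Proof.
move=> /prod_ideal_gen[M hM]; exists M => x xg.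
by rewrite -[M]card_ord -prodr_const; apply: hM.
Qed.

End IdealGen.

(** * Koszul homology and duality *)

(** In the presence of 2-torsion antisymmetry does not make the diagonal vanish, hence the separate
    assumption. *)
Lemma sum_antisym (V : zmodType) (m : nat) (F : 'I_m -> 'I_m -> V) :
  (forall i, F i i = 0) -> (forall i j, F i j = - F j i) ->
  \sum_i \sum_j F i j = 0.
Proof.
elim: m F => [|m IH] F F0 FN; first by rewrite big_ord0.
rewrite big_ord_recl big_ord_recl F0 add0r.
under [X in _ + X]eq_bigr do rewrite big_ord_recl FN.
by rewrite big_split sumrN addNKr IH.
Qed.

Section Koszul.
Context {k : fieldType} {n m : nat} (f : 'I_m -> {mpoly k[n]}).
Local Notation R := {mpoly k[n]}.
Local Notation K := (@koszul k n m).
Implicit Types (x : K) (s : {set 'I_m}) (j l : 'I_m).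

HB.instance Definition _ :=
  GRing.isLinear.Build R K K _ (koszul_diff f) (koszul_diffP f).

(** The sign of sorting e_j /\ e_s: e_j has to pass the elements of s smaller than j. *)
Definition koszul_sign s j : R := (-1) ^+ #|[set i in s | (i < j)%N]|.

Lemma koszul_signK s j : koszul_sign s j * koszul_sign s j = 1.
Proof. by rewrite -expr2 sqrr_sign. Qed.

Lemma koszul_signU s j l :
  l \notin s -> koszul_sign (l |: s) j = (-1) ^+ (l < j)%N * koszul_sign s j.
Proof.
move=> ls; rewrite -exprD; congr (_ ^+ _).
case: (boolP (l < j)%N) => lj /=.
  rewrite (_ : [set i in l |: s | _] = l |: [set i in s | (i < j)%N]).
    by rewrite cardsU1 inE (negPf ls).
  by apply/finset.setP => i; rewrite !inE; case: eqP => [->|].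
apply: eq_card => i; rewrite !inE; case: eqP => [->|//].
by rewrite (negPf lj) (negPf ls).
Qed.

(** The rule e_j /\ e_l = - e_l /\ e_j in terms of signs; it cancels the terms of d(dx) in pairs. *)
Lemma koszul_sign_swap s j l : j != l -> j \notin s -> l \notin s ->
  koszul_sign s j * koszul_sign (j |: s) l
    = - (koszul_sign s l * koszul_sign (l |: s) j).
Proof.
move=> jl js ls; rewrite !koszul_signU //.
case: (ltngtP j l) => [||/val_inj/eqP]; last first.
  by move=> jl'; rewrite jl' in jl.
all: move=> _; rewrite /= expr0 expr1; ring.
Qed.

Lemma koszul_diffE x s : koszul_diff f x s =
  \sum_(j | j \notin s) koszul_sign s j * f j * x (j |: s).
Proof. by rewrite ffunE. Qed.

Lemma koszul_diffK x : koszul_diff f (koszul_diff f x) = 0.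
Proof.
apply/ffunP => s; rewrite koszul_diffE [RHS]ffunE.
pose F j l : R := if [&& j \notin s, l \notin s & j != l] then
  koszul_sign s j * koszul_sign (j |: s) l * (f j * f l * x (l |: (j |: s))) else 0.
transitivity (\sum_j \sum_l F j l).
  rewrite big_mkcond; apply: eq_bigr => j _; case: ifPn => js; last first.
    by rewrite big1 // => l _; rewrite /F (negPf js).
  rewrite koszul_diffE mulr_sumr big_mkcond; apply: eq_bigr => l _.
  rewrite /F js !inE negb_or eq_sym andbC; case: ifP => // _.
  by ring.
apply: sum_antisym => [j|j l]; first by rewrite /F eqxx !andbF.
rewrite /F [l == j]eq_sym andbCA; case: ifP => [|_]; last by rewrite oppr0.
move=> /and3P[ls js jl].
rewrite koszul_sign_swap // finset.setUCA; ring.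
Qed.

(** Left exterior multiplication by e_j. *)
Definition koszul_wedge j x : K :=
  [ffun s : {set 'I_m} => if j \in s then koszul_sign s j * x (s :\ j) else 0].

(** The differential is an antiderivation sending e_j to f_j, so d(e_j /\ x) = f_j x - e_j /\ dx. *)
Lemma koszul_wedge_homotopy j x :
  koszul_diff f (koszul_wedge j x) + koszul_wedge j (koszul_diff f x) = f j *: x.
Proof.
apply/ffunP => s; rewrite [LHS]ffunE [RHS]ffunE koszul_diffE.
rewrite [X in _ + X]ffunE; case: ifPn => js; last first.
  rewrite addr0 (bigD1 j) //= ffunE finset.setU11 finset.setU1K //.
  rewrite big1 => [|l /andP[ls lj]]; last first.
    by rewrite ffunE !inE (negPf js) eq_sym (negPf lj) mulr0.
  rewrite addr0 koszul_signU // ltnn expr0 mul1r.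
  transitivity (koszul_sign s j * koszul_sign s j * (f j * x s)); first by ring.
  by rewrite koszul_signK mul1r.
(* If j is in s, the second summand gives f_j x_s through the index l = j. For the other indices,
   which are those outside s, the two summands cancel by the sign rule. *)
set t := s :\ j; have jt : j \notin t by rewrite !inE eqxx.
have sE : s = j |: t by rewrite finset.setD1K.
rewrite koszul_diffE mulr_sumr [X in _ + X](bigD1 j) //= -sE.
rewrite [X in _ + (_ + X)](eq_bigl (fun l => l \notin s)); last first.
  move=> l; rewrite !inE negb_and negbK.
  by case: (eqVneq l j) => [->|]; rewrite ?js ?andbT.
rewrite addrCA -big_split big1 ?addr0 => [|l ls] /=.
  rewrite {1}sE koszul_signU // ltnn expr0 mul1r.
  transitivity (koszul_sign t j * koszul_sign t j * (f j * x s)); first by ring.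
  by rewrite koszul_signK mul1r.
have lj : j != l by apply: contraNneq ls => <-.
have lt : l \notin t by rewrite !inE negb_and ls orbT.
rewrite ffunE finset.in_setU js orbT.
have -> : (l |: s) :\ j = l |: t.
  apply/finset.setP => i; rewrite !inE.
  by case: (eqVneq i l) => [->|]; rewrite ?andbT // eq_sym lj.
have -> : koszul_sign (l |: s) j = koszul_sign (l |: t) j.
  have jlt : j \notin l |: t by rewrite finset.in_setU1 negb_or lj.
  by rewrite sE finset.setUCA koszul_signU // ltnn expr0 mul1r.
have -> : koszul_sign s j = koszul_sign t j.
  by rewrite sE koszul_signU // ltnn expr0 mul1r.
transitivity ((koszul_sign t j * koszul_sign t l
  + koszul_sign s l * koszul_sign (l |: t) j) * (f l * x (l |: t))); first by ring.
rewrite sE !koszul_signU //; case: (ltngtP j l) => [||jl]; last first.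
  by rewrite (val_inj jl) eqxx in lj.
all: by move=> _; rewrite /= expr0 expr1; ring.
Qed.

End Koszul.

Section KoszulChains.
Context {k : fieldType} {n m : nat} (f : 'I_m -> {mpoly k[n]}).
Local Notation R := {mpoly k[n]}.
Local Notation K := (@koszul k n m).
Implicit Types (x u v : K) (B : submodule R^o) (i : nat).

Lemma koszul_diff_chain i x :
  koszul_chain i.+1 x -> koszul_chain i (koszul_diff f x).
Proof.
move/koszul_chainP => xi; apply/koszul_chainP => s si.
rewrite koszul_diffE big1 // => j js; rewrite xi ?mulr0 //.
by rewrite cardsU1 js add1n eqSS.
Qed.

Lemma koszul_chain_eq0 i x : (m < i)%N -> koszul_chain i x -> x = 0.
Proof.
move=> mi /koszul_chainP xi; apply/ffunP => s; rewrite [RHS]ffunE xi //.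
by rewrite neq_ltn (leq_ltn_trans (max_card _)) // card_ord.
Qed.

Definition chain_in B x := forall s, x s \in B.

Lemma chain_inB B x u : chain_in B x -> chain_in B u -> chain_in B (x - u).
Proof. by move=> xB uB s; rewrite !ffunE; apply: (rpredB (xB s)). Qed.

Lemma chain_inD B x u : chain_in B x -> chain_in B u -> chain_in B (x + u).
Proof. by move=> xB uB s; rewrite !ffunE; apply: (rpredD (xB s)). Qed.

Lemma chain_inZ B (a : R) x : chain_in B x -> chain_in B (a *: x).
Proof. by move=> xB s; rewrite ffunE; apply: ideal_mull. Qed.

Lemma chain_in_scale B (a : R) x : a \in B -> chain_in B (a *: x).
Proof.
by move=> aB s; rewrite ffunE [_ *: _](mulrC a); apply: ideal_mull.
Qed.

Lemma chain_in_diff B x : chain_in B x -> chain_in B (koszul_diff f x).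
Proof.
by move=> xB s; rewrite koszul_diffE; apply: ideal_sum => j _; apply: ideal_mull.
Qed.

Lemma koszul_chainD i x u :
  koszul_chain i x -> koszul_chain i u -> koszul_chain i (x + u).
Proof.
move=> /koszul_chainP xi /koszul_chainP ui; apply/koszul_chainP => s si.
by rewrite ffunE xi // ui // addr0.
Qed.

Lemma koszul_chainZ i (a : R) x : koszul_chain i x -> koszul_chain i (a *: x).
Proof.
move=> /koszul_chainP xi; apply/koszul_chainP => s si.
by rewrite ffunE xi // scaler0.
Qed.

Lemma koszul_chainB i x u :
  koszul_chain i x -> koszul_chain i u -> koszul_chain i (x - u).
Proof.
by move=> xi ui; rewrite -scaleN1r; apply: koszul_chainD => //; apply: koszul_chainZ.
Qed.

(** If g = sum a_j f_j, then exterior multiplication by sum a_j e_j is a homotopy from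
    multiplication by g to 0. The third property makes it usable modulo any ideal [B]. *)
Lemma koszul_homotopy (g : R) : g \in ideal_gen (range f) ->
  exists h : K -> K,
    [/\ forall i x, koszul_chain i x -> koszul_chain i.+1 (h x),
        forall x, koszul_diff f (h x) + h (koszul_diff f x) = g *: x &
        forall B x, chain_in B x -> chain_in B (h x)].
Proof.
move=> /ideal_gen_rangeP[a ->].
exists (fun x => \sum_j a j *: koszul_wedge j x).
split=> [i x /koszul_chainP xi|x|B x xB].
- apply/koszul_chainP => s si; rewrite sum_ffunE big1 // => j _.
  rewrite !ffunE; case: ifP => js; rewrite ?scaler0 //.
  rewrite xi ?mulr0 ?scaler0 //.
  by move: si; rewrite (cardsD1 j) js add1n eqSS.
- rewrite /= linear_sum -big_split scaler_suml; apply: eq_bigr => j _.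
  by rewrite linearZ /= -scalerDr koszul_wedge_homotopy scalerA.
move=> s; rewrite sum_ffunE; apply: ideal_sum => j _; rewrite !ffunE.
apply: ideal_mull; case: ifP => _; first exact: ideal_mull.
exact: (rpred0 B).
Qed.

End KoszulChains.

Lemma mcoeffMX_le (R : nzRingType) (n : nat) (a : {mpoly R[n]}) (m m' : 'X_{1..n}) :
  (a * 'X_[m])@_m' = if (m <= m')%MM then a@_(m' - m) else 0.
Proof.
case: ifPn => [mm'|mm']; first by rewrite -[in LHS](submK mm') addmC mcoeffMX.
apply/memN_msupp_eq0; apply: contra mm'; rewrite (perm_mem (msuppMX _ _)).
by move=> /mapP[u _ ->]; apply: lem_addr.
Qed.

(** * Ideals generated by powers of the first r variables *)

Section BoxIdeal.
Context {k : fieldType} {n : nat}.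
Local Notation R := {mpoly k[n]}.
Implicit Types (a b : R) (N r : nat) (z : int).

Lemma is_formP z a :
  reflect (forall m, (mdeg m)%:Z != z -> a@_m = 0) (is_form z a).
Proof.
case: z => [e|e].
  apply: (iffP idP) => [ae m me|h]; first exact: (dhomog_nemf_coeff ae).
  apply/dhomogP => m; rewrite mcoeff_msupp => am.
  by apply/eqP; apply: contraNT am => /h/eqP.
apply: (iffP eqP) => [-> m _|h]; first by rewrite mcoeff0.
by apply/mpolyP => m; rewrite mcoeff0 h.
Qed.

Lemma is_formM d z a b : is_form z a -> b \is d.-homog -> is_form (z + d%:Z) (a * b).
Proof.
case: z => [e|e] /=; first exact: dhomogM.
by move=> /eqP-> _; rewrite mul0r; apply/is_formP => m _; rewrite mcoeff0.
Qed.

Lemma is_form_sum z I (s : seq I) (P : pred I) (F : I -> R) :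
  (forall i, P i -> is_form z (F i)) -> is_form z (\sum_(i <- s | P i) F i).
Proof.
move=> FP; apply/is_formP => m mz; rewrite raddf_sum big1 // => i /FP.
by move/is_formP; apply.
Qed.

Lemma is_formN z a : is_form z (- a) = is_form z a.
Proof. by case: z => e /=; rewrite ?oppr_eq0 // dhomogN. Qed.

(** Membership in a monomial ideal is tested on coefficients: only monomials with an exponent above
    N in one of the first r variables may occur. *)
Fact box_ideal_closed N r : submod_closed
  ((fun a => `[< forall m : 'X_{1..n}, (forall i : 'I_n, (i < r)%N -> (m i <= N)%N) ->
                 a@_m = 0 >]) : {pred R^o}).
Proof.
split=> [|c a b /asboolP aP /asboolP bP]; apply/asboolP => m mN.
  exact: mcoeff0.
rewrite mcoeffD bP // addr0 mcoeffM big1 // => -[u v] /= /eqP mE.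
rewrite aP ?mulr0 // => i ir; apply: leq_trans (mN i ir).
have -> : m i = (u i + v i)%N by rewrite -mnmDE -mE.
exact: leq_addl.
Qed.

(* The ideal generated by the X_i ^+ N.+1 with i < r. *)
Definition box_ideal N r : submodule R^o := Submodule (box_ideal_closed N r).

Lemma box_idealP N r a : reflect
  (forall m : 'X_{1..n}, (forall i : 'I_n, (i < r)%N -> (m i <= N)%N) -> a@_m = 0)
  (a \in box_ideal N r).
Proof. exact: asboolP. Qed.

Lemma box_ideal0 N a : a \in box_ideal N 0 -> a = 0.
Proof. by move/box_idealP => h; apply/mpolyP => m; rewrite mcoeff0 h. Qed.

Lemma box_idealS N r a : a \in box_ideal N r -> a \in box_ideal N r.+1.
Proof.
by move/box_idealP => h; apply/box_idealP => m mN; apply: h => i /ltnW/mN.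
Qed.

(** The quotient in the division by X_r^(N+1); monomials not divisible by it are dropped. *)
Definition mono_quot N (r : 'I_n) a : R :=
  \sum_(m : 'X_{1..n < msize a}) a@_(m + U_(r) *+ N.+1) *: 'X_[m].

Lemma mcoeff_mono_quot N (r : 'I_n) a m : (mono_quot N r a)@_m = a@_(m + U_(r) *+ N.+1).
Proof.
have [ma|am] := ltnP (mdeg m) (msize a).
  exact: (mcoeff_mpoly (fun m => a@_(m + U_(r) *+ N.+1))).
rewrite [RHS]memN_msupp_eq0; last first.
  by apply: msize_mdeg_ge; rewrite mdegD (leq_trans am) // leq_addr.
rewrite raddf_sum big1 //= => m' _; rewrite mcoeffZ mcoeffX.
case: eqP => [mE|]; last by rewrite mulr0.
by have := bmdeg m'; rewrite mE ltnNge am.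
Qed.

Lemma mono_quot0 N (r : 'I_n) : mono_quot N r 0 = 0.
Proof. by apply/mpolyP => m; rewrite mcoeff_mono_quot !mcoeff0. Qed.

Lemma mono_quot_form N (r : 'I_n) z a :
  is_form (z + N.+1%:Z) a -> is_form z (mono_quot N r a).
Proof.
move/is_formP => az; apply/is_formP => m mz; rewrite mcoeff_mono_quot az //.
by rewrite mdegD mdegMn mdeg1 mul1n PoszD (inj_eq (addIr _)).
Qed.

(** The monomials of the remainder are not divisible by X_r^(N+1), so they lie in the ideal because
    of an earlier variable. *)
Lemma mono_quot_box N (r : 'I_n) a : a \in box_ideal N r.+1 ->
  a - 'X_r ^+ N.+1 * mono_quot N r a \in box_ideal N r.
Proof.
move/box_idealP => h; apply/box_idealP => m mN.
rewrite mcoeffB mulrC mpolyXn mcoeffMX_le mcoeff_mono_quot.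
case: ifPn => [le|le]; first by rewrite submK // subrr.
rewrite subr0 h // => i; rewrite ltnS leq_eqVlt => /predU1P[ir|/mN //].
rewrite leqNgt; apply: contra le => Nm; apply/mnm_lepP => j.
rewrite mulmnE mnm1E -(val_inj ir); case: eqP => [<-|]; rewrite ?mul0n ?mul1n //.
Qed.

(** Multiplication by X_r^(N+1) does not change the exponents of the earlier variables. *)
Lemma box_ideal_regular N (r : 'I_n) a :
  'X_r ^+ N.+1 * a \in box_ideal N r -> a \in box_ideal N r.
Proof.
move/box_idealP => h; apply/box_idealP => m mN.
rewrite -(mcoeffMX a (U_(r) *+ N.+1) m) -mpolyXn mulrC h // => i ir.
by rewrite mnmDE mulmnE mnm1E -val_eqE /= gtn_eqF // mul0n add0n mN.
Qed.

Lemma mono_box_ideal N (i : 'I_n) r : (i < r)%N -> 'X_i ^+ N.+1 \in box_ideal N r.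
Proof.
move=> ir; apply/box_idealP => m /(_ i ir) mi; rewrite mpolyXn mcoeffX.
case: eqP => // mE; move: mi.
by rewrite -mE mulmnE mnm1E eqxx mul1n ltnn.
Qed.

End BoxIdeal.

(** * Koszul complexes modulo powers of variables *)

Section Duality.
Context {k : fieldType} {n : nat} (f : 'I_n.+1 -> {mpoly k[n]}) (N : nat).
Context (f_pow : forall i, 'X_i ^+ N.+1 \in ideal_gen (range f)).
Local Notation R := {mpoly k[n]}.
Local Notation K := (@koszul k n n.+1).
Local Notation B r := (box_ideal N r : submodule R^o).
Local Notation dK := (koszul_diff f).
Implicit Types (x u v w : K) (i r : nat).

Definition chain_quot (r : 'I_n) x : K := [ffun s => mono_quot N r (x s)].

Lemma chain_quot_chain (r : 'I_n) i x :
  koszul_chain i x -> koszul_chain i (chain_quot r x).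
Proof.
move/koszul_chainP => xi; apply/koszul_chainP => s si.
by rewrite ffunE xi // mono_quot0.
Qed.

Lemma chain_quot_box (r : 'I_n) x : chain_in (B r.+1) x ->
  chain_in (B r) (x - 'X_r ^+ N.+1 *: chain_quot r x).
Proof. by move=> xB s; rewrite !ffunE; apply: mono_quot_box. Qed.

Lemma chain_box_regular (r : 'I_n) x :
  chain_in (B r) ('X_r ^+ N.+1 *: x) -> chain_in (B r) x.
Proof. by move=> xB s; apply: box_ideal_regular; have := xB s; rewrite ffunE. Qed.

Lemma chain_boxS r x : chain_in (B r) x -> chain_in (B r.+1) x.
Proof. by move=> xB s; apply: box_idealS. Qed.

(* Depth sensitivity: modulo X_0^(N+1), ..., X_(r-1)^(N+1) the ideal of the f j
   still contains a regular sequence of length n - r. *)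
Lemma koszul_box_exact r i u : (r <= n)%N -> (r.+2 <= i)%N ->
  koszul_chain i u -> chain_in (B r) (dK u) ->
  exists2 v, koszul_chain i.+1 v & chain_in (B r) (u - dK v).
Proof.
move=> rn; rewrite -(subKn rn).
(* Descending induction on r. At r = n the degree i exceeds n + 1, so the chain is 0. *)
elim: (n - r)%N (leq_subr r n) i u => [|e IH] en i u.
  rewrite subn0 => ni /(koszul_chain_eq0 ni) -> _; exists 0.
    by apply/koszul_chainP => s _; rewrite ffunE.
  by rewrite linear0 subr0 => s; rewrite ffunE; apply: (rpred0 (B _)).
set q := (n - e.+1)%N; have qE : (n - e)%N = q.+1 by rewrite /q; lia.
have qn : (q < n)%N by rewrite /q; lia.
move=> qi ui du; pose o := Ordinal qn.
(* Let h be the homotopy for y = X_q^(N+1). Then d(hu) = yu - h(du) vanishes modulo [B q.+1], so by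
   induction hu = dv + z with z in that ideal. The quotient z/y bounds u modulo [B q]: y(u - d(z/y))
   lies in [B q], and y can be cancelled. *)
have [h [hi hE hB]] := koszul_homotopy (f_pow o).
have hu := hi _ _ ui; have dhu : dK (h u) = 'X_o ^+ N.+1 *: u - h (dK u).
  by rewrite -hE addrK.
have [|||v vi hv] := IH _ i.+1 (h u) _ hu; first by lia.
- by rewrite qE.
- rewrite qE dhu; apply: chain_inB; last by apply: chain_boxS; apply: hB.
  by apply: chain_in_scale; apply: mono_box_ideal; rewrite /o /=.
move: hv; rewrite qE => hv; set z := h u - dK v in hv.
exists (chain_quot o z).
  by apply: chain_quot_chain; apply: koszul_chainB => //; apply: koszul_diff_chain.
apply: (@chain_box_regular o).
have -> : 'X_o ^+ N.+1 *: (u - dK (chain_quot o z)) =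
    h (dK u) + dK (z - 'X_o ^+ N.+1 *: chain_quot o z).
  have dz : dK z = 'X_o ^+ N.+1 *: u - h (dK u).
    by rewrite linearB /= koszul_diffK subr0.
  rewrite [dK (z - _)]linearB /= [dK (_ *: _)]linearZ /= dz scalerBr.
  by rewrite addrA [h _ + _]addrC subrK.
apply: chain_inD; first exact: hB.
by apply: chain_in_diff; apply: (@chain_quot_box o).
Qed.

(** The connecting map x |-> dx / X_r^(N+1) sends H_(r+2) modulo [B r.+1] to H_(r+1) modulo [B r]
    and lowers the degree of coefficients by N+1-d. It is injective because H_(r+2) modulo [B r]
    vanishes. So the vanishing assumed for H_1 in degree z propagates to all r. *)
Lemma koszul_box_linkage (d : nat) (z : int) :
  (forall j, f j \is d.-homog) ->
  (forall x, koszul_chain 1 x -> (forall s, is_form z (x s)) -> dK x = 0 ->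
     exists2 v, koszul_chain 2 v & x = dK v) ->
  forall r x, (r <= n)%N -> koszul_chain r.+1 x ->
  (forall s, is_form (z + r%:Z * (N.+1%:Z - d%:Z)) (x s)) ->
  chain_in (B r) (dK x) ->
  exists2 v, koszul_chain r.+2 v & chain_in (B r) (x - dK v).
Proof.
move=> fd H; elim=> [|r IH] x rn xi xz dx.
  have [||v vi ->] := H x xi; last by exists v; rewrite ?subrr // => s;
    rewrite ffunE; apply: (rpred0 (B _)).
  - by move=> s; have := xz s; rewrite mul0r addr0.
  - by apply/ffunP => s; rewrite [RHS]ffunE; apply: (box_ideal0 (dx s)).
(* The chain u represents the image of x under the connecting map. *)
pose o := Ordinal rn; pose u := chain_quot o (dK x).
have hu := @chain_quot_box o _ dx; rewrite -/u in hu.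
have [||||v vi uv] := IH u; first exact: ltnW.
- by apply: chain_quot_chain; apply: koszul_diff_chain.
- move=> s; rewrite ffunE; apply: mono_quot_form; rewrite koszul_diffE.
  apply: is_form_sum => j _; rewrite mulrAC.
  have -> : z + r%:Z * (N.+1%:Z - d%:Z) + N.+1%:Z =
            z + r.+1%:Z * (N.+1%:Z - d%:Z) + d%:Z by lia.
  apply: is_formM => //; rewrite /koszul_sign -signr_odd mulr_sign.
  by case: ifP => _; rewrite ?is_formN.
- apply: (@chain_box_regular o).
  have := chain_in_diff f hu.
  rewrite linearB /= koszul_diffK sub0r linearZ /= => h s.
  by rewrite -(rpredN (B r)); have := h s; rewrite ffunE.
(* Since u = dv modulo [B r], the chain x - X_r^(N+1) v is a cycle modulo [B r], and exactness
   applies to it. *)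
have [||||v' vi' xv'] := @koszul_box_exact r r.+2 (x - 'X_o ^+ N.+1 *: v).
- exact: ltnW.
- by [].
- by apply: koszul_chainB => //; apply: koszul_chainZ.
- have -> : dK (x - 'X_o ^+ N.+1 *: v) = (dK x - 'X_o ^+ N.+1 *: u)
      + 'X_o ^+ N.+1 *: (u - dK v).
    by rewrite linearB linearZ /= scalerBr addrA subrK.
  by apply: chain_inD => //; apply: chain_inZ.
exists v' => //.
have -> : x - dK v' = (x - 'X_o ^+ N.+1 *: v - dK v') + 'X_o ^+ N.+1 *: v.
  by rewrite addrAC subrK.
apply: chain_inD; first exact: chain_boxS.
by apply: chain_in_scale; apply: mono_box_ideal; rewrite /o /=.
Qed.

End Duality.

(** * Macaulay duality for the quotient by the powers of all variables *)

Section Pairing.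
Context {k : fieldType} {n : nat} (f : 'I_n.+1 -> {mpoly k[n]}) (N : nat).
Context (f_pow : forall i, 'X_i ^+ N.+1 \in ideal_gen (range f)).
Local Notation R := {mpoly k[n]}.
Local Notation I := (ideal_gen (range f) : {pred R}).
Local Notation B r := (box_ideal N r : submodule R^o).

Definition form_pairing (e : nat) (phi : 'X_{1..n} -> k) (a : R) : k :=
  \sum_(m : 'X_{1..n < e.+1} | mdeg m == e) a@_m * phi m.

Lemma form_pairing_sum e phi J (s : seq J) (P : pred J) (F : J -> R) :
  form_pairing e phi (\sum_(i <- s | P i) F i) =
  \sum_(i <- s | P i) form_pairing e phi (F i).
Proof.
rewrite exchange_big; apply: eq_bigr => m _.
by rewrite raddf_sum mulr_suml.
Qed.

Lemma form_pairingZ e phi c a : form_pairing e phi (c *: a) = c * form_pairing e phi a.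
Proof. by rewrite mulr_sumr; apply: eq_bigr => m _; rewrite mcoeffZ mulrA. Qed.

Lemma form_pairingX e phi m : mdeg m = e -> form_pairing e phi 'X_[m] = phi m.
Proof.
move=> me; have me' : (mdeg m < e.+1)%N by rewrite me.
rewrite /form_pairing (bigD1 (BMultinom me')) /=; last by rewrite me.
rewrite mcoeffX eqxx mul1r big1 ?addr0 // => m' /andP[_ mm'].
rewrite mcoeffX; case: eqP => [E|]; last by rewrite mul0r.
by move: mm'; rewrite -val_eqE /= E eqxx.
Qed.

(** The columns of the cokernel matrix are functionals that cut out the row space of [M]. *)
Lemma separating_functional (p q : nat) (M : 'M[k]_(p, q)) (h : 'rV[k]_q) :
  ~~ (h <= M)%MS -> exists2 phi : 'cV[k]_q, M *m phi = 0 & h *m phi != 0.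
Proof.
rewrite submxE => /matrix0Pn[i [j hij]]; exists (col j (cokermx M)).
  by rewrite colE mulmxA mulmx_coker mul0mx.
by apply/matrix0Pn; exists i, 0; rewrite colE mulmxA -colE mxE.
Qed.

(** The degree e part of I is spanned by the products of monomials with the f_j that have degree e;
    these are the rows of [M], and h is outside their span. *)
Lemma ideal_form_functional (d e : nat) (h : R) :
  (forall j, f j \is d.-homog) -> h \is e.-homog -> h \notin I ->
  exists2 phi, forall a, a \in I -> form_pairing e phi a = 0 & form_pairing e phi h != 0.
Proof.
move=> fd he hI; pose T := ('X_{1..n < e.+1} : finType).
(* The value 0 on pairs of the wrong degree allows indexing by a full finite type. *)
pose G (x : 'I_n.+1 * T) : R := if (mdeg x.2 + d == e)%N then 'X_[x.2] * f x.1 else 0.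
have Ge x : G x \is e.-homog.
  rewrite /G; case: ifPn => [/eqP xe|_]; last exact: dhomog0.
  by rewrite -[X in X.-homog]xe; apply: dhomogM; rewrite ?dhomogX.
pose row_of (a : R) : 'rV[k]_#|T| := \row_j a@_(enum_val j : T).
pose M : 'M[k]_(#|{: 'I_n.+1 * T}|, #|T|) := \matrix_i row_of (G (enum_val i)).
have [hM|/separating_functional[phi Mphi hphi]] := boolP (row_of h <= M)%MS.
  case/negP: hI; have [c hc] := submxP hM.
  have -> : h = \sum_i c 0 i *: G (enum_val i).
    apply/mpolyP => m; rewrite raddf_sum /=.
    have [me|me] := eqVneq (mdeg m) e; last first.
      rewrite (dhomog_nemf_coeff he) // big1 // => i _.
      by rewrite mcoeffZ (dhomog_nemf_coeff (Ge _)) ?mulr0.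
    have me' : (mdeg m < e.+1)%N by rewrite me.
    pose j := enum_rank (BMultinom me' : T).
    have /rowP/(_ j) := hc; rewrite !mxE enum_rankK /= => ->.
    by apply: eq_bigr => i _; rewrite !mxE enum_rankK mcoeffZ.
  apply: (ideal_sum (B := ideal_mod (range f))) => i _; rewrite -mul_mpolyC.
  apply: ideal_mull; rewrite /G; case: ifP => _; last exact: (rpred0 (ideal_mod _)).
  by apply: ideal_mull; apply: ideal_gen_sub; exists (enum_val i).1.
pose psi (m : 'X_{1..n}) := if insub m is Some m' then phi (enum_rank (m' : T)) 0 else 0.
have psiE (a : R) : a \is e.-homog -> form_pairing e psi a = (row_of a *m phi) 0 0.
  move=> ae; rewrite mxE /form_pairing big_mkcond.
  rewrite (reindex (fun i : 'I_#|T| => (enum_val i : T))) /=; last first.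
    by apply: onW_bij; apply: enum_val_bij.
  apply: eq_bigr => i _; rewrite mxE; case: eqP => [me|/eqP me].
    by rewrite /psi valK enum_valK.
  by rewrite (dhomog_nemf_coeff ae) ?mul0r.
exists psi; last first.
  rewrite psiE //; apply: contraNneq hphi => h0; apply/eqP/matrixP => i j.
  by rewrite !ord1 h0 mxE.
(* Vanishing extends to inhomogeneous elements of I: a product of degree other than e has no
   coefficient that the pairing sees. *)
move=> a /ideal_gen_rangeP[b ->]; rewrite form_pairing_sum big1 // => j _.
rewrite [b j]mpolyE mulr_suml form_pairing_sum big1_seq //= => m _.
rewrite -scalerAl form_pairingZ; have [me|me] := eqVneq (mdeg m + d)%N e.
  have me' : (mdeg m < e.+1)%N by rewrite ltnS -me leq_addr.
  have GE : 'X_[m] * f j = G (j, BMultinom me') by rewrite /G /= me eqxx.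
  rewrite GE psiE //.
  have -> : row_of (G (j, BMultinom me')) = row (enum_rank (j, BMultinom me' : T)) M.
    by rewrite rowK enum_rankK.
  by rewrite -row_mul Mphi !mxE mulr0.
have ae : 'X_[m] * f j \is (mdeg m + d).-homog by apply: dhomogM; rewrite ?dhomogX.
rewrite /form_pairing big1 ?mulr0 // => m' /eqP m'e.
by rewrite (dhomog_nemf_coeff ae) ?mul0r // [X in X != _]m'e eq_sym.
Qed.

Definition box_top : 'X_{1..n} := [multinom N | i < n].

Lemma mdeg_box_top : mdeg box_top = (n * N)%N.
Proof.
rewrite mdegE (eq_bigr (fun=> N)) ?sum_nat_const ?card_ord // => i _.
by rewrite mnmE.
Qed.

Lemma notin_box_ideal m : ~~ (m <= box_top)%MM -> 'X_[m] \in I.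
Proof.
move=> /mnm_lepP mN; have [i] : exists i, (N < m i)%N.
  apply: contrapT => h; apply: mN => i; rewrite mnmE leqNgt; apply/negP => Nm.
  by apply: h; exists i.
move=> Nm; have le : (U_(i) *+ N.+1 <= m)%MM.
  by apply/mnm_lepP => j; rewrite mulmnE mnm1E; case: eqP => [<-|]; rewrite ?mul1n ?mul0n.
rewrite -(submK le) mpolyXD -mpolyXn.
by apply: (ideal_mull (B := ideal_mod (range f))).
Qed.

(* Macaulay duality: a form of degree e outside I is detected by a functional
   vanishing on I, and that functional is multiplication by w modulo the
   X_i ^+ N.+1, read off at the socle monomial. *)
Lemma forms_in_ideal (d e : nat) :
  (forall j, f j \is d.-homog) ->
  (forall w, is_form ((n * N)%N%:Z - e%:Z) w ->
     (forall j, f j * w \in B n) -> w \in B n) ->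
  forall h, h \is e.-homog -> h \in I.
Proof.
move=> fd W h he; case: (boolP (h \in I)) => // hI.
have [phi phiI phih] := ideal_form_functional fd he hI.
(* The coefficient of aw at a monomial q below the top one is then phi(a X^(top - q)). *)
pose w : R := \sum_(m : 'X_{1..n < e.+1} | (mdeg m == e) && (m <= box_top)%MM)
  phi m *: 'X_[box_top - m].
have wE a q : (q <= box_top)%MM ->
    (a * w)@_q = form_pairing e phi (a * 'X_[box_top - q]).
  move=> qN; rewrite mulr_sumr raddf_sum /form_pairing.
  rewrite [RHS](bigID (fun m : 'X_{1..n < e.+1} => (m <= box_top)%MM)) /=.
  (* A monomial with an exponent above N lies in I, so phi is 0 on it. *)
  rewrite [X in _ = _ + X]big1 ?addr0; last first.
    move=> m /andP[/eqP me mN]; rewrite -(form_pairingX phi me) phiI ?mulr0 //.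
    exact: notin_box_ideal.
  apply: eq_bigr => m /andP[_ mN]; rewrite -scalerAr mcoeffZ !mcoeffMX_le mulrC.
  move/mnm_lepP: qN => qN; move/mnm_lepP: mN => mN; congr (_ * _).
  have -> : (box_top - m <= q)%MM = (box_top - q <= m)%MM.
    apply/mnm_lepP/mnm_lepP => H i; have := H i; have := qN i; have := mN i;
    rewrite !mnmBE; lia.
  case: ifP => // _; congr mcoeff; apply/mnmP => i; rewrite !mnmBE.
  have := qN i; have := mN i; lia.
have /W wB : is_form ((n * N)%N%:Z - e%:Z) w.
  apply: is_form_sum => m /andP[/eqP me mN]; apply/is_formP => u ue.
  rewrite mcoeffZ mcoeffX; case: eqP => [uE|]; last by rewrite mulr0.
  have E := mdegD (box_top - m) m; rewrite submK // mdeg_box_top uE in E.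
  by case/eqP: ue; move: me E; lia.
have {}wB : w \in B n.
  apply: wB => j; apply/box_idealP => q qN; rewrite wE.
    apply: phiI; rewrite mulrC; apply: (ideal_mull (B := ideal_mod (range f))).
    by apply: ideal_gen_sub; exists j.
  by apply/mnm_lepP => i; rewrite mnmE; apply: qN.
(* The coefficient of hw at the socle monomial is phi(h), which is nonzero, whereas membership in
   [B n] makes it 0. *)
have /box_idealP/(_ box_top) : h * w \in B n by apply: ideal_mull.
rewrite wE ?lepm_refl // => h0.
case/eqP: phih; rewrite -h0; last by move=> i _; rewrite mnmE.
congr form_pairing; rewrite (_ : box_top - box_top = 0)%MM ?mpolyX0 ?mulr1 //.
by apply/mnmP => i; rewrite mnmBE subnn mnm0E.
Qed.

End Pairing.

(** The case r = n of the linkage: a chain of degree n+1 is a single coefficient w, its differential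
    has the coefficients f_j w up to sign, and there are no chains of degree n+2. So if w multiplies
    I into the ideal of powers, then w lies in that ideal. *)
Lemma koszul_duality {k : fieldType} {n : nat} (f : 'I_n.+1 -> {mpoly k[n]})
    (N d e : nat) :
  (forall i, 'X_i ^+ N.+1 \in ideal_gen (range f)) ->
  (forall j, f j \is d.-homog) ->
  (forall x : koszul, koszul_chain 1 x ->
     (forall s, is_form (n%:Z * (d%:Z - 1) - e%:Z) (x s)) ->
     koszul_diff f x = 0 -> exists2 v, koszul_chain 2 v & x = koszul_diff f v) ->
  forall h, h \is e.-homog -> h \in ideal_gen (range f).
Proof.
move=> f_pow fd H; apply: (forms_in_ideal f_pow fd) => w wz fw.
pose x : koszul := [ffun s : {set 'I_n.+1} => if s == finset.setT then w else 0].
have xc : koszul_chain n.+1 x.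
  apply/koszul_chainP => s sn; rewrite ffunE; case: eqP => // sE.
  by rewrite sE cardsT card_ord eqxx in sn.
have [||v vc] := koszul_box_linkage f_pow fd H (leqnn n) xc.
- move=> s; rewrite ffunE; case: ifP => _; last by apply/is_formP => m _; rewrite mcoeff0.
  (* The degrees match: n(d-1) - e + n(N+1-d) = nN - e. *)
  by congr (is_form _ w): wz; lia.
- move=> s; rewrite koszul_diffE; apply: ideal_sum => j _; rewrite -mulrA.
  apply: ideal_mull; rewrite ffunE; case: ifP => _; first exact: fw.
  by rewrite mulr0; apply: (rpred0 (box_ideal _ _)).
rewrite (koszul_chain_eq0 _ vc) // linear0 subr0 => /(_ finset.setT).
by rewrite ffunE eqxx.
Qed.

(** [infimum] is a chosen value, so an infimum must first be shown to exist; the lower bound [z0]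
    gives a least degree. *)
Lemma indeg_le (M : zmodType) (part : int -> set M) (z0 : int) :
  (forall z x, part z x -> x <> 0 -> z0 <= z) ->
  forall z x, part z x -> x <> 0 -> (indeg part <= z%:E)%E.
Proof.
move=> lb z x px x0; rewrite /indeg /infimum; set A := [set _ | _ in _].
have Az : A z%:E by exists z => //; exists x.
case: ifPn => [/eqP A0|_]; first by move: Az; rewrite A0.
suff /(xgetPex +oo%E)[lbA _] : exists y, infimums A y by apply: lbA.
pose P (i : nat) := `[< exists2 y, part (z0 + i%:Z) y & y <> 0 >].
have exP : exists i, P i.
  exists `|z - z0|%N; apply/asboolP; exists x => //.
  by have -> : z0 + `|z - z0|%N = z by have := lb _ _ px x0; lia.
have [i /asboolP[y py y0] imin] := ex_minnP exP.
exists (z0 + i%:Z)%:E; split=> [_ [w [v pv v0] <-]|w]; last first.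
  by apply; exists (z0 + i%:Z) => //; exists y.
have zw := lb _ _ pv v0; rewrite lee_fin.
have /imin : P `|w - z0|%N.
  by apply/asboolP; exists v => //; have -> : z0 + `|w - z0|%N = w by lia.
lia.
Qed.

Lemma koszul_homotopy_cycle {k : fieldType} {n m : nat} (f : 'I_m -> {mpoly k[n]})
    (g : {mpoly k[n]}) i (x : koszul) :
  g \in ideal_gen (range f) -> koszul_chain i x -> koszul_diff f x = 0 ->
  exists2 u, koszul_chain i.+1 u & g *: x = koszul_diff f u.
Proof.
move=> /koszul_homotopy[h [hi hE hB]] xi dx; exists (h x); first exact: hi.
rewrite -hE dx; suff -> : h 0 = 0 by rewrite addr0.
(* Only the three properties of h are known; the third one, for the zero ideal, gives h(0) = 0. *)
apply/ffunP => s; rewrite [RHS]ffunE; apply: (@box_ideal0 _ _ 0).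
by apply: hB => t; rewrite ffunE; apply: (rpred0 (box_ideal 0 0)).
Qed.

(** * The threshold degree and the vanishing of cycle classes *)

Section Threshold.
Context {k : fieldType} {n : nat} (d : nat) (f : 'I_n.+1 -> {mpoly k[n]}).
Local Notation R := {mpoly k[n]}.

Lemma maxideal_range : maxideal = ideal_gen (range (fun i : 'I_n => 'X_i : R)).
Proof.
rewrite /maxideal; congr ideal_gen; apply/predeqP => r.
by split=> [[i ->]|[i _ <-]]; exists i.
Qed.

Lemma primary_var_pow : is_m_primary (ideal_of f) ->
  exists N, forall i : 'I_n, 'X_i ^+ N.+1 \in ideal_gen (range f).
Proof.
move=> [_ radE].
have /choice[N hN] (i : 'I_n) : exists N, 'X_i ^+ N \in ideal_gen (range f).
  suff : radical [set` ideal_of f] 'X_i by case=> N; exists N.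
  by rewrite radE; apply: ideal_gen_sub; exists i.
exists (\max_i N i)%N => i.
have le : (N i <= (\max_i N i).+1)%N by apply/leqW/leq_bigmax.
rewrite -(subnK le) exprD.
by apply: (ideal_mull (B := ideal_mod (range f))).
Qed.

Lemma ideal_pow_sub (B : submodule R^o) (L : nat) :
  (forall i : 'I_n, 'X_i ^+ L \in B) ->
  exists M, forall r, r \in ideal_pow [set` maxideal] M -> r \in B.
Proof.
move=> /prod_ideal_gen[M hM]; exists M => r /asboolP[p [a [g [gM ->]]]].
apply: ideal_sum => i _; apply: ideal_mull; have [x [xm ->]] := gM i.
by apply: hM => j; rewrite -maxideal_range; apply: xm.
Qed.

(** Otherwise x has a nonzero class in H_1 of degree nu = n(d-1) - e + d. It is torsion, as I kills
    Koszul homology and contains a power of the maximal ideal. Hence the threshold is at least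
    (n-1)(d-1) - (nu - d) = e - d + 1, which exceeds mu. *)
Lemma threshold_boundary (mu : int) (e : nat) (x : koszul) :
  is_m_primary (ideal_of f) -> (threshold d f <= mu%:E)%E -> mu + d%:Z <= e%:Z ->
  koszul_chain 1 x ->
  (forall s, is_form (n%:Z * (d%:Z - 1) - e%:Z) (x s)) ->
  koszul_diff f x = 0 -> exists2 v, koszul_chain 2 v & x = koszul_diff f v.
Proof.
move=> /primary_var_pow[N f_pow] thr mue x1 xe dx.
suff : x \in koszul_boundary f 1 by move/asboolP.
apply/negPn/negP => xB.
have xZ : x \in koszul_cycle f 1 by apply/andP; split=> //; apply/eqP.
pose z : submod_of (Submodule (koszul_cycle_closed f 1)) :=
    @SubmodOf _ _ (Submodule (koszul_cycle_closed f 1)) x xZ.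
pose c : koszul_homology f 1 := subquot_class _ z.
have c0 : c <> 0.
  by move=> /subquot_class_eq0; apply/negP.
pose nu := n%:Z * (d%:Z - 1) - e%:Z + d%:Z.
have cnu : koszul_torsion_part d f 1 nu c.
  split.
    exists z => // s; have := xe s; congr is_form.
    by rewrite /nu mul1n addrK.
  have [M hM] := ideal_pow_sub (B := ideal_mod (range f)) f_pow.
  exists M => r /hM rI; have [u u2 ux] := koszul_homotopy_cycle rI x1 dx.
  rewrite -[r *: c]linearZ; apply/subquot_class_eq0/asboolP.
  by exists u.
(* In degree z' < 0 the coefficients would have negative degree z' - d. *)
have nu_ge z' y : koszul_torsion_part d f 1 z' y -> y <> 0 -> 0 <= z'.
  case=> [[[y' y'Z] /= ye yE] _] y0; rewrite leNgt; apply/negP => z'0; apply: y0.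
  rewrite yE; apply/subquot_class_eq0 => /=.
  suff -> : y' = 0 by apply: (rpred0 (Submodule (koszul_boundary_closed f 1))).
  apply/ffunP => s; rewrite ffunE; apply/mpolyP => m; rewrite mcoeff0.
  by move/is_formP: (ye s); apply; apply/eqP; lia.
have le := indeg_le nu_ge cnu c0.
have : (((n%:Z - 1) * (d%:Z - 1))%:E - (nu%:E - d%:Z%:E) <= mu%:E)%E.
  apply: le_trans thr; apply: leeB => //.
  by rewrite ge_min leeB ?orbT.
rewrite -EFinB lee_fin /nu; lia.
Qed.

End Threshold.

(** * The Rees ideal as the torsion of the symmetric algebra *)

Section ReesEval.
Context {R : comNzRingType} {n : nat} (f : 'I_n -> R).
Local Notation S := {mpoly R[n]}.
Implicit Types (s t : S) (m : 'X_{1..n}) (i j : 'I_n).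

(** The map T_i |-> f_i t onto the Rees algebra, with ['X] in the role of t. *)
Definition rees_eval : S -> {poly R} := mmap (@polyC R) (fun i => (f i)%:P * 'X).

HB.instance Definition _ := GRing.RMorphism.on rees_eval.

Definition gen_mono m : R := \prod_i f i ^+ m i.

Lemma rees_evalX m : rees_eval 'X_[m] = (gen_mono m)%:P * 'X^(mdeg m).
Proof.
rewrite /rees_eval mmapX /mmap1 rmorph_prod mdegE -prodrXr -big_split.
by apply: eq_bigr => i _; rewrite exprMn rmorphXn.
Qed.

Lemma rees_evalXi i : rees_eval 'X_i = (f i)%:P * 'X.
Proof. by rewrite /rees_eval mmapX mmap1U. Qed.

Lemma rees_evalZ c s : rees_eval (c *: s) = c%:P * rees_eval s.
Proof. by rewrite /rees_eval mmapZ. Qed.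

Lemma coef_rees_eval s l :
  (rees_eval s)`_l = \sum_(m <- msupp s | mdeg m == l) s@_m * gen_mono m.
Proof.
rewrite {1}[s]mpolyE rmorph_sum /= coef_sum [RHS]big_mkcond; apply: eq_bigr => m _.
rewrite rees_evalZ rees_evalX mulrA -polyCM coefCM coefXn eq_sym.
by case: eqP => _; rewrite ?mulr1 ?mulr0.
Qed.

Lemma coef_rees_evalwE b s l : (msize s <= b)%N ->
  (rees_eval s)`_l = \sum_(m : 'X_{1..n < b} | mdeg m == l) s@_m * gen_mono m.
Proof.
move=> sb; rewrite {1}(mpolywE sb) rmorph_sum /= coef_sum [RHS]big_mkcond.
apply: eq_bigr => m _; rewrite rees_evalZ rees_evalX mulrA -polyCM coefCM coefXn eq_sym.
by case: eqP => _; rewrite ?mulr1 ?mulr0.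
Qed.

Lemma gen_mono0 : gen_mono 0%MM = 1.
Proof. by apply: big1 => i _; rewrite mnm0E. Qed.

Lemma mcoeff0_rees_eval s : s@_0%MM = (rees_eval s)`_0.
Proof.
rewrite coef_rees_eval; have [s0|s0] := boolP (0%MM \in msupp s).
  rewrite big_mkcond (bigD1_seq 0%MM) ?msupp_uniq //= mdeg0 eqxx gen_mono0 mulr1.
  by rewrite big1 ?addr0 // => m; rewrite mdeg_eq0 => /negPf->.
rewrite memN_msupp_eq0 // big_seq_cond big1 // => m /andP[ms].
by rewrite mdeg_eq0 => /eqP mE; rewrite mE (negPf s0) in ms.
Qed.

End ReesEval.

Section SymmetricAlgebra.
Context {k : fieldType} {n : nat} (f : 'I_n.+1 -> {mpoly k[n]}).
Local Notation R := {mpoly k[n]}.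
Local Notation S := {mpoly R[n.+1]}.
Implicit Types (s : S) (i j : 'I_n.+1).
Context (Sym : comAlgType R) (iota : {linear submod_of (ideal_of f) -> Sym}).

(** The map x |-> xt, which the universal property extends to the symmetric algebra. *)
Definition rees_lin (x : submod_of (ideal_of f)) : {poly R} := submod_val x *: 'X.

Fact rees_lin_is_linear : linear rees_lin.
Proof. by move=> a x y; rewrite /rees_lin scalerA -scalerDl. Qed.

HB.instance Definition _ :=
  GRing.isLinear.Build R (submod_of (ideal_of f)) {poly R} _ rees_lin rees_lin_is_linear.

(** [rees_eval] factors through the symmetric algebra, and R[t] has no torsion: powers of the
    variable [i0] are nonzero divisors. *)
Lemma rees_eval_torsion (i0 : 'I_n) s : is_symmetric_algebra iota ->
  torsion Sym (to_sym iota s) -> rees_eval f s = 0.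
Proof.
move=> /(_ _ rees_lin)[h [hE _]] [M tors].
have hs : h (to_sym iota s) = rees_eval f s.
  rewrite /to_sym /rees_eval /mmap rmorph_sum; apply: eq_bigr => m _.
  rewrite rmorphM /= rmorph_alg alg_polyC; congr (_ * _).
  rewrite rmorph_prod; apply: eq_bigr => i _; rewrite rmorphXn /= hE.
  by rewrite /rees_lin /= mul_polyC.
have XM : 'X_i0 ^+ M \in ideal_pow [set` (maxideal : {pred R})] M.
  apply: ideal_gen_sub; exists (fun=> 'X_i0); split; last by rewrite prodr_const card_ord.
  by move=> _; apply: ideal_gen_sub; exists i0.
rewrite -hs; apply/polyP => l; rewrite coef0.
have /(congr1 (fun p : {poly R} => p`_l))/eqP : 'X_i0 ^+ M *: h (to_sym iota s) = 0.
  by rewrite -linearZ tors // linear0.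
by rewrite coefZ coef0 mulf_eq0 mpolyXn -msupp_eq0 msuppX => /eqP.
Qed.

(** Write e_i for the class of f_i in Sym. Since f_i e_j = f_j e_i, multiplying by a high power of
    f_i turns every e_j into e_i, and the result depends only on [rees_eval f s]. So each f_i has a
    power that kills the image of s, and then so does a power of the maximal ideal. *)
Lemma torsion_rees_eval s : is_m_primary (ideal_of f) ->
  rees_eval f s = 0 -> torsion Sym (to_sym iota s).
Proof.
move=> /primary_var_pow[N f_pow] s0; set x := to_sym iota s.
pose e i := iota (ideal_gen_elt f i).
have fe i j : f i *: e j = f j *: e i.
  rewrite -!linearZ; congr (iota _); apply: val_inj => /=.
  exact: mulrC.
have ann_closed : submod_closed ((fun a : R => a *: x == 0) : {pred R^o}).
  split=> [|c a b /eqP ax /eqP bx]; first by rewrite unfold_in scale0r.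
  by rewrite unfold_in scalerDl bx addr0 -[c *: a]/(c * a) -scalerA ax scaler0.
pose ann : submodule R^o := Submodule ann_closed.
suff fL i : f i ^+ msize s \in ann.
  have [M1 hM1] := ideal_gen_pow fL.
  have [M hM] : exists M, forall r, r \in ideal_pow [set` maxideal] M -> r \in ann.
    by apply: (@ideal_pow_sub _ _ _ (N.+1 * M1)) => i; rewrite exprM; apply: hM1.
  by exists M => r /hM/eqP.
set L := msize s.
(* Recovers f_i^L x from the Rees image: t^l becomes f_i^(L-l) e_i^l. *)
pose Phi (p : {poly R}) := \sum_(l < L) (f i ^+ (L - l) * p`_l) *: e i ^+ l.
have -> : (f i ^+ L \in ann) = (f i ^+ L *: x == 0) by [].
suff -> : f i ^+ L *: x = Phi (rees_eval f s).
  by rewrite s0 /Phi big1 // => l _; rewrite coef0 mulr0 scale0r.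
have PhiD p q : Phi (p + q) = Phi p + Phi q.
  rewrite /Phi -big_split; apply: eq_bigr => l _.
  by rewrite coefD mulrDr scalerDl.
have Phi0 : Phi 0 = 0 by rewrite /Phi big1 // => l _; rewrite coef0 mulr0 scale0r.
rewrite /x /to_sym /rees_eval /mmap (big_morph Phi PhiD Phi0) scaler_sumr.
rewrite big_seq [RHS]big_seq; apply: eq_bigr => m ms.
have mL : (mdeg m < L)%N := msize_mdeg_lt ms.
have -> : mmap1 (fun i0 => (f i0)%:P * 'X) m = (gen_mono f m)%:P * 'X^(mdeg m).
  by rewrite -rees_evalX /rees_eval mmapX.
rewrite mulrA -polyCM /Phi (bigD1 (Ordinal mL)) //= big1 ?addr0; last first.
  move=> l; rewrite -val_eqE /= => lm.
  by rewrite coefCM coefXn (negPf lm) !mulr0 scale0r.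
rewrite coefCM coefXn eqxx mulr1.
have key : f i ^+ mdeg m *: mmap1 e m = gen_mono f m *: e i ^+ mdeg m.
  rewrite /mmap1 mdegE -!prodrXr -!scaler_prod; apply: eq_bigr => j _.
  by rewrite -!exprZn fe.
rewrite -[mmap1 _ m]/(mmap1 e m) mulr_algl -{1}(subnK (ltnW mL)) exprD scalerA mulrAC.
by rewrite -[LHS]scalerA key scalerA mulrA.
Qed.

End SymmetricAlgebra.

(** * The map delta *)

Section MonomialExtension.
Context {R : comNzRingType} {n : nat} {V : lmodType R} (D : 'X_{1..n} -> V).

Definition mono_ext (s : {mpoly R[n]}) : V := \sum_(m <- msupp s) s@_m *: D m.

Lemma mono_extwE b s : (msize s <= b)%N ->
  mono_ext s = \sum_(m : 'X_{1..n < b}) s@_m *: D m.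
Proof.
move=> sb; rewrite /mono_ext (big_mksub 'X_{1..n < b}) ?msupp_uniq //=; last first.
  by move=> m /msize_mdeg_lt /leq_trans; apply.
by rewrite big_rmcond //= => m /memN_msupp_eq0 ->; rewrite scale0r.
Qed.

Fact mono_ext_is_linear : linear mono_ext.
Proof.
move=> c s t; pose b := maxn (msize (c *: s + t)) (maxn (msize s) (msize t)).
rewrite !(@mono_extwE b) ?leq_max ?leqnn ?orbT // scaler_sumr -big_split.
by apply: eq_bigr => m _; rewrite mcoeffD mcoeffZ scalerDl scalerA.
Qed.

HB.instance Definition _ :=
  GRing.isLinear.Build R {mpoly R[n]} V _ mono_ext mono_ext_is_linear.

Lemma mono_extX m : mono_ext 'X_[m] = D m.
Proof. by rewrite /mono_ext msuppX big_seq1 mcoeffX eqxx scale1r. Qed.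

End MonomialExtension.

Lemma ideal_scale (R : comNzRingType) (n : nat) (B : submodule {mpoly R[n]}^o)
  (c : R) s : s \in B -> c *: s \in B.
Proof. by move=> sB; rewrite -mul_mpolyC; apply: ideal_mull. Qed.

Section Delta.
Context {R : idomainType} {n : nat} (f : 'I_n -> R).
Local Notation S := {mpoly R[n]}.
Implicit Types (s t : S) (m u : 'X_{1..n}) (i j : 'I_n) (c : R).
Local Notation rees_eval := (rees_eval f).

(* [KS f] is the case R = k[X_1, ..., X_n]. *)
Definition minors_ideal : submodule S^o :=
  ideal_mod [set s | exists i j, s = f i *: 'X_j - f j *: 'X_i].
Local Notation KS := minors_ideal.

(* Modulo KS it does not matter which variable of the monomial is evaluated. *)
Definition delta_mono m : S :=
  if [pick i | m i != 0%N] is Some i then f i *: 'X_[m - U_(i)] else 0.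

(** A lift of delta to S, exactly linear over R but linear over S only modulo KS and away from
    constant terms; constants go to 0. *)
Definition delta : S -> S := mono_ext delta_mono.

HB.instance Definition _ := GRing.Linear.on delta.

(** For i != j the difference is X^u (f_i T_j - f_j T_i) up to notation, where u is m with both
    variables removed. *)
Lemma KS_mono m i j : m i != 0%N -> m j != 0%N ->
  f i *: 'X_[m - U_(i)] - f j *: 'X_[m - U_(j)] \in KS.
Proof.
have [->|ij] := eqVneq i j; first by rewrite subrr => _ _; apply: (rpred0 KS).
move=> mi mj; pose u := (m - U_(i) - U_(j))%MM.
have iE : (m - U_(i) = u + U_(j))%MM.
  by rewrite submK // lep1mP mnmBE mnm1E (negPf ij) subn0.
have jE : (m - U_(j) = u + U_(i))%MM.
  rewrite /u submDA [(U_(i) + _)%MM]addmC -submDA submK //.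
  by rewrite lep1mP mnmBE mnm1E [j == i]eq_sym (negPf ij) subn0.
rewrite iE jE !mpolyXD !scalerAr -mulrBr; apply: (ideal_mull (B := KS)).
by apply: ideal_gen_sub; exists i, j.
Qed.

Lemma delta_mono_KS m i : m i != 0%N ->
  delta_mono m - f i *: 'X_[m - U_(i)] \in KS.
Proof.
move=> mi; rewrite /delta_mono; case: pickP => [j mj|/(_ i)]; first exact: KS_mono.
by rewrite mi.
Qed.

Lemma deltaX m : delta 'X_[m] = delta_mono m.
Proof. exact: mono_extX. Qed.

Lemma delta_mulX i s : delta ('X_i * s) - f i *: s \in KS.
Proof.
rewrite [s]mpolyE mulr_sumr linear_sum scaler_sumr -sumrB.
apply: (ideal_sum (B := KS)) => m _; rewrite -scalerAr linearZ /=.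
rewrite scalerA [f i * _]mulrC -scalerA -scalerBr.
apply: (ideal_scale (B := KS)); rewrite -mpolyXD deltaX.
have := @delta_mono_KS (U_(i) + m) i; rewrite addmC addmK; apply.
by rewrite mnmDE mnm1E eqxx addn1.
Qed.

(** In a product of monomials the variable to evaluate may be taken from the second factor, provided
    that this factor is not constant. *)
Lemma delta_mul (a s : S) : s@_0%MM = 0 -> delta (a * s) - a * delta s \in KS.
Proof.
move=> s0; rewrite [a]mpolyE !mulr_suml linear_sum -sumrB.
apply: (ideal_sum (B := KS)) => u _; rewrite -!scalerAl linearZ -scalerBr /=.
apply: (ideal_scale (B := KS)); rewrite [s]mpolyE linear_sum !mulr_sumr linear_sum -sumrB.
rewrite big_seq; apply: (ideal_sum (B := KS)) => m ms.
rewrite linearZ -!scalerAr linearZ -scalerBr /=; apply: (ideal_scale (B := KS)).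
rewrite -mpolyXD !deltaX.
have m0 : m != 0%MM by apply: contraTneq ms => ->; rewrite mcoeff_msupp s0 eqxx.
rewrite {2}/delta_mono; case: pickP => [i mi|m0']; last first.
  case/eqP: m0; apply/mnmP => i; rewrite mnm0E.
  by have /negbFE/eqP := m0' i.
have := @delta_mono_KS (u + m) i; rewrite -addmBA; last by rewrite lep1mP.
by rewrite mpolyXD scalerAr; apply; rewrite mnmDE addn_eq0 negb_and mi orbT.
Qed.

Lemma delta_KS s : s \in KS -> delta s \in KS.
Proof.
move=> /asboolP[p [a [g [gE ->]]]].
rewrite linear_sum; apply: (ideal_sum (B := KS)) => l _ /=.
have [i [j ->]] := gE l.
have -> : delta (a l * (f i *: 'X_j - f j *: 'X_i)) =
    f i *: (delta ('X_j * a l) - f j *: a l) - f j *: (delta ('X_i * a l) - f i *: a l).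
  rewrite !scalerBr !scalerA [f j * f i]mulrC opprB addrA subrK.
  by rewrite mulrC mulrBl -!scalerAl linearB !linearZ.
by apply: (ideal_sub (B := KS)); apply: (ideal_scale (B := KS)); apply: delta_mulX.
Qed.

Lemma rees_eval_KS s : s \in KS -> rees_eval s = 0.
Proof.
move=> /asboolP[p [a [g [gE ->]]]]; rewrite rmorph_sum big1 // => l _.
have [i [j ->]] := gE l; rewrite rmorphM rmorphB /= !rees_evalZ !rees_evalXi.
by rewrite !mulrA [(f j)%:P * _]mulrC subrr mulr0.
Qed.

(** Replacing one T_i by f_i removes one factor t. *)
Lemma rees_eval_delta s : s@_0%MM = 0 -> rees_eval (delta s) * 'X = rees_eval s.
Proof.
move=> s0; rewrite [s]mpolyE linear_sum !rmorph_sum mulr_suml.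
rewrite big_seq [RHS]big_seq; apply: eq_bigr => m ms.
rewrite linearZ /= !rees_evalZ -mulrA deltaX; congr (_ * _).
have m0 : m != 0%MM by apply: contraTneq ms => ->; rewrite mcoeff_msupp s0 eqxx.
rewrite /delta_mono; case: pickP => [i mi|m0']; last first.
  case/eqP: m0; apply/mnmP => i; rewrite mnm0E.
  by have /negbFE/eqP := m0' i.
rewrite -[in RHS](@submK _ U_(i) m) ?lep1mP // mpolyXD rmorphM /= rees_evalZ.
by rewrite rees_evalXi mulrCA mulrA.
Qed.

Lemma msize_delta s l : (msize s <= l.+1)%N -> (msize (delta s) <= l)%N.
Proof.
move=> sl; rewrite /delta /mono_ext big_seq.
elim/big_ind: _ => [|x y xl yl|m ms]; first by rewrite mmeasure0.
  by apply: leq_trans (mmeasureD_le _ _ _) _; rewrite geq_max xl yl.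
apply: leq_trans (msizeZ_le _ _) _; rewrite /delta_mono.
case: pickP => [i mi|_]; last by rewrite mmeasure0.
apply: leq_trans (msizeZ_le _ _) _; rewrite mmeasureX.
have le : (U_(i) <= m)%MM by rewrite lep1mP.
have := mdegD (m - U_(i)) U_(i); rewrite submK // mdeg1 addn1 => <-.
exact: leq_trans (msize_mdeg_lt ms) sl.
Qed.

Lemma mul_var_decomposition s : s@_0%MM = 0 ->
  exists q : 'I_n -> S, s = \sum_i 'X_i * q i.
Proof.
move=> s0; rewrite [s]mpolyE big_seq; elim/big_ind: _ => [|x y [p ->] [q ->]|m ms].
- by exists (fun=> 0); rewrite big1 // => i _; rewrite mulr0.
- by exists (fun i => p i + q i); rewrite -big_split; apply: eq_bigr => i _;
    rewrite mulrDr.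
have [i mi] : exists i, m i != 0%N.
  apply/existsP; apply: contraTT ms => /existsPn m0.
  rewrite mcoeff_msupp (_ : m = 0%MM) ?s0 ?eqxx //; apply/mnmP => i.
  by rewrite mnm0E; have := m0 i; rewrite negbK => /eqP.
exists (fun j => if j == i then s@_m *: 'X_[m - U_(i)] else 0).
rewrite (bigD1 i) //= eqxx big1 ?addr0 => [|j /negPf->]; last by rewrite mulr0.
by rewrite -scalerAr -mpolyXD addmC submK // lep1mP.
Qed.

(** The generator f_i T_j - f_j T_i has q_i = T_j and q_j = -T_i, a Koszul syzygy of the variables
    T. *)
Lemma KS_syzygy s : s \in KS -> exists2 q : 'I_n -> S,
  s = \sum_i f i *: q i & \sum_i 'X_i * q i = 0.
Proof.
move=> /asboolP[p [a [g [gE ->]]]]; elim/big_ind: _ => [|x y [q -> q0] [r -> r0]|l _].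
- by exists (fun=> 0); rewrite big1 // => i _; rewrite ?scaler0 ?mulr0.
- exists (fun i => q i + r i).
    by rewrite -big_split; apply: eq_bigr => i _; rewrite scalerDr.
  by under eq_bigr do rewrite mulrDr; rewrite big_split /= q0 r0 addr0.
have [i [j ->]] := gE l.
exists (fun h => (if h == i then a l * 'X_j else 0) - (if h == j then a l * 'X_i else 0)).
  under eq_bigr do rewrite scalerBr; rewrite sumrB.
  rewrite [X in _ = _ - X](bigD1 j) //= [X in _ = X - _](bigD1 i) //= !eqxx.
  by rewrite !big1 ?addr0 ?mulrBr ?scalerAr // => h /negPf->; rewrite scaler0.
under eq_bigr do rewrite mulrBr; rewrite sumrB.
rewrite (bigD1 i) //= eqxx [X in _ - X](bigD1 j) //= eqxx.
rewrite !big1 ?addr0 => [|h /negPf->|h /negPf->]; rewrite ?mulr0 //.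
by rewrite mulrCA [X in _ - X]mulrCA ['X_i * _]mulrC subrr.
Qed.

(** J<l> with J replaced by the kernel of [rees_eval], so that delta can be studied without the
    symmetric algebra. *)
Definition rees_le (l : nat) : submodule S^o :=
  ideal_mod [set s | rees_eval s = 0 /\ (msize s <= l.+1)%N].

Lemma rees_le_eval l s : s \in rees_le l -> rees_eval s = 0.
Proof.
move=> /asboolP[p [a [g [gE ->]]]]; rewrite rmorph_sum big1 // => i _.
by rewrite rmorphM /= (gE i).1 mulr0.
Qed.

Lemma rees_eval_mcoeff0 s : rees_eval s = 0 -> s@_0%MM = 0.
Proof. by rewrite (mcoeff0_rees_eval f) => ->; rewrite coef0. Qed.

Lemma rees_le_sub l l' s : (l <= l')%N -> s \in rees_le l -> s \in rees_le l'.
Proof.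
move=> ll' /asboolP[p [a [g [gE ->]]]].
apply: (ideal_sum (B := rees_le l')) => i _.
apply: (ideal_mull (B := rees_le l')).
have [g0 gl] := gE i; apply: ideal_gen_sub; split=> //.
exact: leq_trans gl _.
Qed.

Lemma KS_rees_le l s : (0 < l)%N -> s \in KS -> s \in rees_le l.
Proof.
move=> l0 /asboolP[p [a [g [gE ->]]]].
apply: (ideal_sum (B := rees_le l)) => h _.
apply: (ideal_mull (B := rees_le l)).
have [i [j gh]] := gE h; apply: ideal_gen_sub; split.
  by apply: rees_eval_KS; apply: ideal_gen_sub; exact: gE.
rewrite gh; apply: leq_trans (mmeasureD_le _ _ _) _; rewrite geq_max mmeasureN.
by rewrite !(leq_trans (msizeZ_le _ _)) // mmeasureX /= mdeg1.
Qed.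

Lemma delta_rees_le l s : s \in rees_le l.+2 -> delta s \in rees_le l.+1.
Proof.
move=> /asboolP[p [a [g [gE ->]]]].
rewrite linear_sum; apply: (ideal_sum (B := rees_le l.+1)) => i _ /=.
have [g0 gl] := gE i; rewrite -[delta _](subrK (a i * delta (g i))).
have g00 := rees_eval_mcoeff0 g0.
apply: (ideal_add (B := rees_le l.+1)).
  by apply: KS_rees_le => //; apply: delta_mul.
apply: (ideal_mull (B := rees_le l.+1)); apply: ideal_gen_sub.
split; last exact: msize_delta.
have /eqP := rees_eval_delta g00; rewrite g0 mulf_eq0 polyX_eq0 orbF.
by move/eqP.
Qed.

(** On a generator delta is a constant in T; as its Rees image is 0, it is 0. *)
Lemma delta_rees_le1 s : s \in rees_le 1 -> delta s \in KS.
Proof.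
move=> /asboolP[p [a [g [gE ->]]]].
rewrite linear_sum; apply: (ideal_sum (B := KS)) => i _ /=.
have [g0 gl] := gE i; have g00 := rees_eval_mcoeff0 g0.
suff d0 : delta (g i) = 0 by have := delta_mul (a i) g00; rewrite d0 mulr0 subr0.
have /eqP := rees_eval_delta g00; rewrite g0 mulf_eq0 polyX_eq0 orbF => /eqP.
have := msize_delta gl; case: (leqP (msize (delta (g i))) 1) => // /msize1_polyC -> _.
rewrite /rees_eval mmapC => /eqP; rewrite polyC_eq0 => /eqP->.
by rewrite mpolyC0.
Qed.

Lemma delta_kernel s : s@_0%MM = 0 -> delta s \in KS -> s \in rees_le 1.
Proof.
move=> s0 ds; have [q sE] := mul_var_decomposition s0.
have : \sum_i f i *: q i \in KS.
  have -> : \sum_i f i *: q i = delta s - \sum_i (delta ('X_i * q i) - f i *: q i).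
    by rewrite sumrB {1}sE linear_sum opprB addrC subrK.
  apply: (ideal_sub (B := KS)) => //; apply: (ideal_sum (B := KS)) => i _.
  exact: delta_mulX.
(* Subtracting the syzygy r keeps s unchanged and makes sum f_i v_i exactly 0. *)
move=> /KS_syzygy[r rE r0]; pose v i := q i - r i.
have {}sE : s = \sum_i 'X_i * v i.
  by under eq_bigr do rewrite mulrBr; rewrite sumrB r0 subr0.
have v0 : \sum_i f i *: v i = 0.
  by under eq_bigr do rewrite scalerBr; rewrite sumrB rE subrr.
(* For each monomial m in T, the coefficients of the v_i at m form a syzygy of f, hence a linear
   form in T lying in J. *)
pose b := (\max_i msize (v i))%N.
have vE i : v i = \sum_(m : 'X_{1..n < b}) (v i)@_m *: 'X_[m].
  by apply: mpolywE; apply: (leq_bigmax (F := fun i => msize (v i))).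
rewrite sE; under eq_bigr do rewrite vE mulr_sumr.
rewrite exchange_big; apply: (ideal_sum (B := rees_le 1)) => m _.
under eq_bigr do rewrite -scalerAr scalerAl mulrC; rewrite -mulr_sumr.
apply: (ideal_mull (B := rees_le 1)); apply: ideal_gen_sub; split.
  rewrite rmorph_sum /=; under eq_bigr do rewrite rees_evalZ rees_evalXi mulrA -polyCM.
  rewrite -mulr_suml -rmorph_sum /= (_ : \sum_i _ = 0) ?mul0r //.
  have := congr1 (mcoeff m) v0; rewrite raddf_sum mcoeff0; apply: etrans.
  by apply: eq_bigr => i _; rewrite /= mcoeffZ mulrC.
elim/big_ind: _ => [|x y xl yl|i _]; first by rewrite mmeasure0.
  by apply: leq_trans (mmeasureD_le _ _ _) _; rewrite geq_max xl yl.
by apply: leq_trans (msizeZ_le _ _) _; rewrite mmeasureX /= mdeg1.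
Qed.

End Delta.

Lemma delta_Tpoly_KS (k : fieldType) (n q : nat) (f : 'I_n.+1 -> {mpoly k[n]})
    (c : q.+1.-tuple 'I_n.+1 -> {mpoly k[n]}) :
  delta f (Tpoly c) - delta_Tpoly f c \in minors_ideal f.
Proof.
rewrite /Tpoly /delta_Tpoly linear_sum -sumrB.
apply: (ideal_sum (B := minors_ideal f)) => t _ /=.
rewrite linearZ -scalerA -scalerBr /=; apply: (ideal_scale (B := minors_ideal f)).
by case/tupleP: t => i t; rewrite theadE big_cons; apply: delta_mulX.
Qed.

(** * Compatibility of delta with the X-grading, and lifting along delta *)

Section GradedDelta.
Context {R : idomainType} {n : nat} (f : 'I_n -> R) (d : nat).
Local Notation S := {mpoly R[n]}.
Local Notation rees_eval := (rees_eval f).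
Local Notation delta := (delta f).
Local Notation rees_le := (rees_le f).
Local Notation KS := (minors_ideal f).
Implicit Types (s t g : S) (m u : 'X_{1..n}) (i j : 'I_n) (a b c : R) (z : int).

(* [pr z] is the projection onto the component of degree z of a grading of R
   for which the f i have degree d. *)
Context (pr : int -> {additive R -> R}).
Context (pr_idem : forall z a, pr z (pr z a) = pr z a).
Context (pr_mul : forall z a i, pr z (a * f i) = pr (z - d%:Z) a * f i).

Definition graded_in z s := forall m, pr z s@_m = s@_m.

Definition graded_part z s : S := map_mpoly (pr z) s.

HB.instance Definition _ z :=
  GRing.isAdditive.Build S S (graded_part z) (map_mpoly_is_additive (pr z)).

Lemma mcoeff_graded_part z s m : (graded_part z s)@_m = pr z s@_m.
Proof. exact: mcoeff_map_mpoly. Qed.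

Lemma graded_part_in z s : graded_in z (graded_part z s).
Proof. by move=> m; rewrite mcoeff_graded_part pr_idem. Qed.

Lemma graded_part_id z s : graded_in z s -> graded_part z s = s.
Proof. by move=> sz; apply/mpolyP => m; rewrite mcoeff_graded_part sz. Qed.

Lemma graded_partX z s u : graded_part z ('X_[u] * s) = 'X_[u] * graded_part z s.
Proof.
apply/mpolyP => m; rewrite mcoeff_graded_part ['X_[u] * s]mulrC ['X_[u] * _]mulrC.
rewrite !mcoeffMX_le; case: ifP => _; last exact: raddf0.
by rewrite mcoeff_graded_part.
Qed.

Lemma msize_graded_part z s : (msize (graded_part z s) <= msize s)%N.
Proof.
rewrite msizeE; apply/bigmax_leqP_seq => m; rewrite mcoeff_msupp mcoeff_graded_part.
move=> sm _; apply: msize_mdeg_lt; rewrite mcoeff_msupp.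
by apply: contraNneq sm => ->; rewrite raddf0.
Qed.

Lemma pr_mulXn z a i e : pr z (a * f i ^+ e) = pr (z - (d * e)%N%:Z) a * f i ^+ e.
Proof.
elim: e z a => [|e IH] z a; first by rewrite muln0 subr0 expr0 !mulr1.
rewrite exprS mulrA IH pr_mul -mulrA; congr (pr _ _ * _).
by rewrite mulnS PoszD; lia.
Qed.

Lemma pr_gen_mono z a m :
  pr z (a * gen_mono f m) = pr (z - (d * mdeg m)%N%:Z) a * gen_mono f m.
Proof.
rewrite /gen_mono mdegE; elim: (index_enum _) z a => [|i r IH] z a.
  by rewrite !big_nil muln0 subr0 !mulr1.
rewrite !big_cons mulrA IH pr_mulXn -mulrA; congr (pr _ _ * _).
by rewrite mulnDr PoszD; lia.
Qed.

(** As a product of l of the f_i has degree dl, the degree z + dl part of the coefficient of t^l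
    comes exactly from the degree z part of s. *)
Lemma rees_eval_graded_part z s :
  rees_eval s = 0 -> rees_eval (graded_part z s) = 0.
Proof.
move=> s0; apply/polyP => l; rewrite coef0.
rewrite (coef_rees_evalwE _ _ (msize_graded_part z s)).
have := congr1 (fun p : {poly R} => pr (z + (d * l)%N%:Z) p`_l) s0.
rewrite coef0 raddf0 (coef_rees_evalwE _ _ (leqnn (msize s))) raddf_sum.
apply: etrans; apply: eq_bigr => m /eqP ml.
by rewrite pr_gen_mono mcoeff_graded_part ml addrK.
Qed.

Lemma graded_in_sum z I (r : seq I) (P : pred I) (F : I -> S) :
  (forall x, P x -> graded_in z (F x)) -> graded_in z (\sum_(x <- r | P x) F x).
Proof.
by move=> FP m; rewrite !raddf_sum; apply: eq_bigr => x Px; apply: (FP x Px m).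
Qed.

Lemma graded_inX z a u : pr z a = a -> graded_in z (a *: 'X_[u]).
Proof.
move=> az m; rewrite mcoeffZ mcoeffX; case: eqP => _; first by rewrite mulr1.
by rewrite mulr0 raddf0.
Qed.

Lemma graded_in_mulX z s u : graded_in z s -> graded_in z ('X_[u] * s).
Proof.
by move=> sz m; rewrite -mcoeff_graded_part graded_partX graded_part_id.
Qed.

Lemma delta_graded z s : graded_in z s -> graded_in (z + d%:Z) (delta s).
Proof.
move=> sz; rewrite /delta /mono_ext; apply: graded_in_sum => m _.
rewrite /delta_mono; case: pickP => [i _|_].
  by rewrite scalerA; apply: graded_inX; rewrite pr_mul addrK sz.
by rewrite scaler0 => u; rewrite mcoeff0 raddf0.
Qed.

(** Projecting an expression in the generators to degree z, with the scalars from R absorbed into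
    the generators, leaves multiples by monomials in T of homogeneous generators. *)
Lemma rees_le_graded_ind l z (P : S -> Prop) :
  P 0 -> (forall s t, P s -> P t -> P (s + t)) ->
  (forall u g, rees_eval g = 0 -> (msize g <= l.+1)%N -> graded_in z g ->
     P ('X_[u] * g)) ->
  forall s, s \in rees_le l -> graded_in z s -> P s.
Proof.
move=> P0 PD PX s /asboolP[p [a [g [gE ->]]]] /graded_part_id <-.
rewrite raddf_sum; elim/big_ind: _ => // i _.
have [g0 gl] := gE i; rewrite [a i]mpolyE mulr_suml raddf_sum.
elim/big_ind: _ => // u _ /=; rewrite -scalerAl scalerAr graded_partX; apply: PX.
- by apply: rees_eval_graded_part; rewrite rees_evalZ g0 mulr0.
- apply: leq_trans (msize_graded_part _ _) _.
  exact: leq_trans (msizeZ_le _ _) gl.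
exact: graded_part_in.
Qed.

Section Lift.
Context (mu : int).
Context (pr_lift : forall c, pr (mu + d%:Z) c = c ->
  exists b : 'I_n -> R, c = \sum_i b i * f i).

Lemma graded_lift c : pr (mu + d%:Z) c = c ->
  exists2 b : 'I_n -> R, forall i, pr mu (b i) = b i & c = \sum_i b i * f i.
Proof.
move=> cmu; have [b cE] := pr_lift cmu; exists (fun i => pr mu (b i)) => //.
rewrite -cmu {1}cE raddf_sum; apply: eq_bigr => i _.
by rewrite pr_mul addrK.
Qed.

Lemma delta_lift_gen l g : rees_eval g = 0 -> (msize g <= l.+1)%N ->
  graded_in (mu + d%:Z) g ->
  exists2 h, [/\ rees_eval h = 0, (msize h <= l.+2)%N & graded_in mu h] &
    delta h - g \in KS.
Proof.
move=> g0 gl gmu.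
have /choice[b bE] m : exists b : 'I_n -> R,
    (forall i, pr mu (b i) = b i) /\ g@_m = \sum_i b i * f i.
  by have [b] := graded_lift (gmu m); exists b.
(* Each coefficient sum b_i f_i of g becomes sum b_i T_i, so the Rees image is multiplied by t and
   stays 0. *)
pose h := \sum_(m <- msupp g) \sum_i b m i *: 'X_[U_(i) + m].
have hE : rees_eval h = rees_eval g * 'X.
  rewrite [g in RHS]mpolyE !rmorph_sum mulr_suml; apply: eq_bigr => m _ /=.
  rewrite rees_evalZ {1}(bE m).2 !rmorph_sum !mulr_suml; apply: eq_bigr => i _ /=.
  rewrite rees_evalZ mpolyXD rmorphM /= rees_evalXi polyCM -!mulrA.
  by congr (_ * (_ * _)); rewrite mulrC.
exists h; first split.
- by rewrite hE g0 mul0r.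
- rewrite /h big_seq; elim/big_ind: _ => [|x y xl yl|m ms]; first by rewrite mmeasure0.
    by apply: leq_trans (mmeasureD_le _ _ _) _; rewrite geq_max xl yl.
  elim/big_ind: _ => [|x y xl yl|i _]; first by rewrite mmeasure0.
    by apply: leq_trans (mmeasureD_le _ _ _) _; rewrite geq_max xl yl.
  apply: leq_trans (msizeZ_le _ _) _; rewrite mmeasureX /= mdegD mdeg1 add1n ltnS.
  exact: leq_trans (msize_mdeg_lt ms) gl.
- apply: graded_in_sum => m _; apply: graded_in_sum => i _.
  by apply: graded_inX; apply: (bE m).1.
rewrite [g in X in _ - X]mpolyE linear_sum -sumrB.
apply: (ideal_sum (B := KS)) => m _ /=.
rewrite {1}(bE m).2 scaler_suml linear_sum -sumrB; apply: (ideal_sum (B := KS)) => i _ /=.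
rewrite linearZ -scalerA -scalerBr /=; apply: (ideal_scale (B := KS)).
by rewrite mpolyXD; apply: delta_mulX.
Qed.

Lemma delta_lift l s : s \in rees_le l -> graded_in (mu + d%:Z) s ->
  exists2 h, h \in rees_le l.+1 /\ graded_in mu h & delta h - s \in KS.
Proof.
move=> sl smu; move: s sl smu; apply: rees_le_graded_ind => [|s t|u g g0 gl gmu].
- exists 0; last by rewrite linear0 subrr; apply: (rpred0 KS).
  split=> [|m]; first exact: (rpred0 (rees_le _)).
  by rewrite mcoeff0 raddf0.
- move=> [h [hl hmu] hs] [h' [h'l h'mu] h't]; exists (h + h').
    split=> [|m]; first exact: (ideal_add (B := rees_le _)).
    by rewrite mcoeffD raddfD hmu h'mu.
  rewrite linearD opprD addrACA; exact: (ideal_add (B := KS)).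
have [h [h0 hl hmu] hg] := delta_lift_gen g0 gl gmu; exists ('X_[u] * h).
  split; last exact: graded_in_mulX.
  by apply: (ideal_mull (B := rees_le _)); apply: ideal_gen_sub.
rewrite -[delta _](subrK ('X_[u] * delta h)) -addrA -mulrBr.
apply: (ideal_add (B := KS)); last exact: (ideal_mull (B := KS)).
by apply: delta_mul; apply: rees_eval_mcoeff0 h0.
Qed.

End Lift.
End GradedDelta.

(** * Downgrading *)

Section FormPart.
Context {k : fieldType} {n : nat}.
Local Notation R := {mpoly k[n]}.
Implicit Types (a g : R) (z : int).

Definition form_part z a : R :=
  if z is Posz e then pihomog mdeg e a else 0.

Fact form_part_is_additive z : additive (form_part z).
Proof. by case: z => e a b /=; rewrite ?pihomogB ?subr0. Qed.

HB.instance Definition _ z :=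
  GRing.isAdditive.Build R R (form_part z) (form_part_is_additive z).

Lemma form_part_is_form z a : is_form z (form_part z a).
Proof. by case: z => e /=; rewrite ?pihomogP. Qed.

Lemma form_partP z a : is_form z a <-> form_part z a = a.
Proof.
split=> [|<-]; last exact: form_part_is_form.
by case: z => e /=; [apply: pihomog_dE | move/eqP].
Qed.

Lemma form_part_mul d z a g : g \is d.-homog ->
  form_part z (a * g) = form_part (z - d%:Z) a * g.
Proof.
move=> gd; rewrite {1}[a]mpolyE mulr_suml raddf_sum /=.
rewrite [X in form_part _ X]mpolyE raddf_sum mulr_suml /=; apply: eq_bigr => m _.
have Xg : a@_m *: 'X_[m] * g \is (mdeg m + d).-homog.
  by apply: dhomogM; rewrite ?dhomogZ ?dhomogX.
have fX z' : form_part z' (a@_m *: 'X_[m]) =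
    if (mdeg m)%:Z == z' then a@_m *: 'X_[m] else 0.
  case: z' => [e|e] //=; rewrite linearZ /= pihomogX eqz_nat.
  by case: ifP => // _; rewrite scaler0.
rewrite fX; case: eqP => [mz|/eqP mz].
  by apply/form_partP; rewrite (_ : z = (mdeg m + d)%N%:Z) //; lia.
rewrite mul0r; case: z mz => [e|//] mz /=; apply: pihomog_ne0 Xg.
by apply: contra mz => /eqP <-; apply/eqP; lia.
Qed.

End FormPart.

Section Assembly.
Context {k : fieldType} {n : nat} (d : nat) (f : 'I_n.+1 -> {mpoly k[n]}).
Context (Sym : comAlgType {mpoly k[n]}) (iota : {linear submod_of (ideal_of f) -> Sym}).
Local Notation R := {mpoly k[n]}.
Local Notation S := {mpoly R[n.+1]}.
Context (f_homog : forall i, f i \is d.-homog).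
Context (f_primary : is_m_primary (ideal_of f)).

Lemma Jle_rees_le (i0 : 'I_n) l (s : S) : is_symmetric_algebra iota ->
  (s \in Jle iota l) = (s \in rees_le f l).
Proof.
move=> univ; apply/asboolP/asboolP => -[p [a [g [gE ->]]]]; exists p, a, g;
  split=> // i; have [gJ gl] := gE i; split=> //.
  exact: rees_eval_torsion i0 _ univ gJ.
exact: torsion_rees_eval.
Qed.

Lemma is_Xform_graded z (s : S) :
  is_Xform z s <-> graded_in (fun z => form_part z : {additive R -> R}) z s.
Proof.
split=> [/is_XformP sz m|sz]; first exact/form_partP.
by apply/is_XformP => m; apply/form_partP; apply: sz.
Qed.

(** Combines duality with the vanishing above the threshold, applied to e = mu + d; in negative
    degree the only form is 0. *)
Lemma forms_above_threshold (mu : int) (c : R) :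
  (threshold d f <= mu%:E)%E -> is_form (mu + d%:Z) c ->
  exists b : 'I_n.+1 -> R, c = \sum_i b i * f i.
Proof.
move=> thr; case E : (mu + d%:Z) => [e|e] /=; last first.
  by move/eqP->; exists (fun=> 0); rewrite big1 // => i _; rewrite mul0r.
move=> ce; apply/ideal_gen_rangeP; have [N f_pow] := primary_var_pow f_primary.
apply: (koszul_duality f_pow f_homog _ ce) => x x1 xe dx.
by apply: (threshold_boundary f_primary thr _ x1 xe dx); rewrite E.
Qed.

End Assembly.

Theorem proposition4 (k : fieldType) (n d : nat)
    (f : 'I_n.+1 -> {mpoly k[n]})
    (Sym : comAlgType {mpoly k[n]}) (iota : {linear submod_of (ideal_of f) -> Sym})
    (hn : (2 <= n)%N) (hd : (1 <= d)%N)
    (f_homog : forall i, f i \is d.-homog)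
    (f_free : forall c : 'I_n.+1 -> k, \sum_i c i *: f i = 0 -> forall i, c i = 0)
    (f_dim : krull_dim (range (fun P : {mpoly k[n.+1]} =>
                                 P \mPo [tuple f i | i < n.+1]))
             = krull_dim [set: {mpoly k[n]}])
    (f_primary : is_m_primary (ideal_of f))
    (Sym_univ : is_symmetric_algebra iota)
    (p : nat) (mu : int) (hp : (2 <= p)%N)
    (hmu : (threshold d f <= mu%:E)%E) :
  exists phi : {linear Jgraded iota p mu -> Jgraded iota p.-1 (mu + d%:Z)},
    is_downgrading phi /\ bijective phi.
Proof.
case: p hp => [|[|l]] //= _.
have i0 : 'I_n := Ordinal (ltnW hn).
pose pr z : {additive {mpoly k[n]} -> {mpoly k[n]}} := form_part z.
have pr_idem z a : pr z (pr z a) = pr z a by apply/form_partP/form_part_is_form.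
have pr_mul z a i : pr z (a * f i) = pr (z - d%:Z) a * f i by apply: form_part_mul.
have lift := delta_lift pr_idem pr_mul
  (fun c (cmu : pr (mu + d%:Z) c = c) => forms_above_threshold f_homog f_primary hmu
     ((form_partP _ _).2 cmu)).
have JE r s : (s \in Jle iota r) = (s \in rees_le f r) by exact: Jle_rees_le.
have s0 r s : s \in Jle iota r -> s@_0%MM = 0.
  by rewrite JE => /rees_le_eval; apply: rees_eval_mcoeff0.
have KSE s : (s \in KS f) = (s \in minors_ideal f) by [].
(* For every l, KS lies in the submodule divided out in the target, so congruences modulo KS become
   equalities of classes. *)
have KS_pred s : s \in KS f -> s \in Jpred iota l.+1.
  by rewrite /Jpred; case: l {hmu lift} => [|l] //=; rewrite KSE JE; apply: KS_rees_le.
set A := Xpart (Jle iota l.+2) mu; set A' := Xpart (Jle iota l.+1) (mu + d%:Z).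
set B := Xpart (Jpred iota l.+2) mu; set B' := Xpart (Jpred iota l.+1) (mu + d%:Z).
have B'E s : s \in A' -> s \in Jpred iota l.+1 -> s \in B'.
  by move=> /andP[_ sX] sJ; apply/andP.
have delta_Xform s : is_Xform mu s -> is_Xform (mu + d%:Z) (delta f s).
  by move=> /is_Xform_graded sX; apply/is_Xform_graded; apply: delta_graded.
have deltaA s : s \in A -> delta f s \in A'.
  move=> /andP[sJ sX]; apply/andP; split; last exact: delta_Xform.
  by rewrite JE; apply: delta_rees_le; rewrite -JE.
pose g (s : submod_of A) : submod_of A' := SubmodOf (deltaA _ (submod_valP s)).
have gP s : submod_val (g s) \in A' := submod_valP (g s).
have g_linear a s t : submod_val (g (a *: s + t)) -
    (a *: submod_val (g s) + submod_val (g t)) \in B'.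
  apply: B'E; first by rewrite rpredB // rpredD // rpredZ.
  apply: KS_pred; rewrite KSE.
  have sJ : submod_val s \in Jle iota l.+2 by have /andP[] := submod_valP s.
  have := delta_mul f (coef_incl a) (s0 _ _ sJ).
  have -> : submod_val (g (a *: s + t)) =
    delta f (coef_incl a * submod_val s) + delta f (submod_val t) by rewrite -linearD.
  by rewrite opprD addrACA subrr addr0.
have g_B s : submod_val s \in B -> submod_val (g s) \in B'.
  move=> /andP[sJ _]; apply: B'E => //; move: sJ; rewrite /Jpred /=.
  case: (l) => [|l'] /=; rewrite !JE; first exact: delta_rees_le1.
  exact: delta_rees_le.
have [phi phiE] := subquot_induced g_linear g_B.
exists phi; split.
  move=> q c s; rewrite KSE => sc; exists (g s); last exact: phiE.
  rewrite KSE.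
  (* Since delta preserves KS, the choice of the coefficient family does not matter. *)
  have -> : submod_val (g s) - delta_Tpoly f c =
      delta f (submod_val s - Tpoly c) + (delta f (Tpoly c) - delta_Tpoly f c).
    by rewrite linearB addrA subrK.
  have dc := delta_Tpoly_KS f c.
  exact: (ideal_add (B := minors_ideal f) (delta_KS sc) dc).
apply: (subquot_induced_bij phiE) => [s gs|t].
  have /andP[sJ sX] := submod_valP s.
  apply/andP; split=> //; move: gs => /andP[gs gX]; rewrite /Jpred /= JE.
  have ds := delta_kernel (s0 _ _ sJ).
  move: gs; rewrite /Jpred; case: (l) => [|l'] /=; first exact: ds.
  (* Here p >= 3 and delta(s) lies in J<p-2>. Lift it to h in J<p-1>; then delta(s - h) is in KS, so
     s - h is in J<1>, which is contained in J<p-1>. *)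
  rewrite JE => /lift[|h [hJ hX] hs]; first exact/is_Xform_graded.
  rewrite -[submod_val s](subrK h); apply: (ideal_add (B := rees_le f _)) => //.
  apply: (@rees_le_sub _ _ _ 1) => //; apply: delta_kernel.
    by rewrite raddfB /= (s0 _ _ sJ) (rees_eval_mcoeff0 (rees_le_eval hJ)) subrr.
  rewrite linearB -opprB; rewrite (rpredN (minors_ideal f)); exact: hs.
(* Surjectivity: t in J<p-1> of X-degree mu + d lifts to J<p> in X-degree mu. *)
have /andP[tJ tX] := submod_valP t.
have [||h [hJ hX] ht] := lift l.+1 (submod_val t); first by rewrite -JE.
  exact/is_Xform_graded.
have hA : h \in A by apply/andP; split; [rewrite JE | apply/is_Xform_graded].
exists (SubmodOf hA); apply: B'E; last exact: KS_pred.
by rewrite rpredB // submod_valP.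
Qed.
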